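(* Let $M\ge 2$, $d_1,\dots,d_M\in\mathbb{N}_{>0}$, $d=\sum_{m=1}^M d_m$, and write $\mathbb{R}^d=\times_{m=1}^M\mathbb{R}^{d_m}$. Let $\mathcal P$ be a class of Borel probability measures on $\mathbb{R}^d$ containing the $d$-dimensional Gaussian distributions. For $m\in\{1,\dots,M\}$ let $k_m:\mathbb{R}^{d_m}\times\mathbb{R}^{d_m}\to\mathbb{R}$ be a continuous bounded translation-invariant characteristic kernel, and let $k=\otimes_{m=1}^M k_m$. For $X\sim\mathbb{P}\in\mathcal P$ let $C_X=\mu_k(\mathbb{P})-\mu_k\left(\otimes_{m=1}^M\mathbb{P}_m\right)\in\mathcal H_k$ be the centered cross-covariance operator. Then there exists a constant $c>0$ such that, for every integer $n\ge 2$, $$\inf_{\hat F_n}\ \sup_{\mathbb{P}\in\mathcal P}\ \mathbb{P}^n\left\{\left\|C_X-\hat F_n\right\|_{\mathcal H_k}\ge\frac{c}{\sqrt n}\right\}\ \ge\ \frac{1-\sqrt{5/8}}{2},$$ where the infimum is over all estimators $\hat F_n$ of $C_X$ based on $n$ i.i.d. samples from $\mathbb{P}$.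
   Context: A kernel on $\mathbb{R}^d$ is a function $k:\mathbb{R}^d\times\mathbb{R}^d\to\mathbb{R}$ for which there are a Hilbert space $\mathcal H$ and a map $\phi:\mathbb{R}^d\to\mathcal H$ with $k(\mathbf x,\mathbf x')=\langle\phi(\mathbf x),\phi(\mathbf x')\rangle_{\mathcal H}$ for all $\mathbf x,\mathbf x'$; its reproducing kernel Hilbert space (RKHS) is denoted $\mathcal H_k$ and its canonical feature map is $\phi_k(\mathbf x)=k(\cdot,\mathbf x)\in\mathcal H_k$. All kernels are assumed measurable and bounded. A kernel is translation-invariant if $k(\mathbf x,\mathbf x')=\kappa(\mathbf x-\mathbf x')$ for some positive definite function $\kappa:\mathbb{R}^d\to\mathbb{R}$, where positive definite means $\sum_{i,j=1}^n c_ic_j\kappa(\mathbf x_i-\mathbf x_j)\ge 0$ for all $n\in\mathbb{N}_{>0}$, $c_i\in\mathbb{R}$, $\mathbf x_i\in\mathbb{R}^d$. For a Borel probability measure $\mathbb{P}$ on $\mathbb{R}^d$ the mean embedding is the Bochner integral $\mu_k(\mathbb{P})=\int_{\mathbb{R}^d}\phi_k(\mathbf x)\,\mathrm d\mathbb{P}(\mathbf x)\in\mathcal H_k$. The kernel $k$ is characteristic if $\mathbb{P}\mapsto\mu_k(\mathbb{P})$ is injective on Borel probability measures. The product kernel is $\left(\otimes_{m=1}^M k_m\right)\left((\mathbf x_m)_{m=1}^M,(\mathbf x_m')_{m=1}^M\right)=\prod_{m=1}^M k_m(\mathbf x_m,\mathbf x_m')$. For a Borel probability measure $\mathbb{P}$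 on $\mathbb{R}^d=\times_{m=1}^M\mathbb{R}^{d_m}$, $\mathbb{P}_m$ is its marginal on $\mathbb{R}^{d_m}$ and $\otimes_{m=1}^M\mathbb{P}_m$ is the product of the marginals. $\mathbb{P}^n$ is the $n$-fold product measure of $\mathbb{P}$ on $(\mathbb{R}^d)^n$. An estimator $\hat F_n$ of $C_X$ based on $n$ samples is an $\mathcal H_k$-valued measurable function on $(\mathbb{R}^d)^n$. *)

(* Defs.v *)
From HB Require Import structures.
From mathcomp Require Import all_boot all_order all_algebra.
From mathcomp Require Import all_classical all_reals all_analysis.
From mathcomp Require Import measurable_realfun.

Set Implicit Arguments.
Unset Strict Implicit.
Unset Printing Implicit Defensive.

Import Order.TTheory GRing.Theory Num.Theory.
Import numFieldNormedType.Exports.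

Local Open Scope classical_set_scope.
Local Open Scope ring_scope.

(* R^n with its Borel sigma-algebra. As a type it is 'rV[R]_n. *)
Notation borelRV R n := (g_sigma_algebraType (@open 'rV[R]_n)).

Section borel_measurability.
Context {R : realType}.

Lemma measurable_open_rV n (U : set 'rV[R]_n) :
  open U -> measurable (U : set (borelRV R n)).
Proof. by move=> oU; exact: sub_sigma_algebra. Qed.

Lemma measurable_coord n (j : 'I_n) :
  measurable_fun [set: borelRV R n] (fun x : borelRV R n => x ord0 j).
Proof.
apply: (measurability _ (RGenOpens.measurableE R)) => _ [_ [a [b ->]] <-].
rewrite setTI; apply: measurable_open_rV.
apply: open_comp; last exact: interval_open.
by move=> x _; exact: coord_continuous.
Qed.

Lemma mx_ballE n (x y : 'rV[R]_n) e : 0 < e ->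
  ball x e y <-> forall j, `|x ord0 j - y ord0 j| < e.
Proof.
move=> e0; split=> [[_ xy] j|xy]; first exact: xy.
by split=> // i j; rewrite ord1; exact: xy.
Qed.

Lemma open_rat_balls n (U : set 'rV[R]_n) : open U ->
  U = \bigcup_(i : 'rV[rat]_n * nat) [set y | (forall j,
         `|ratr (i.1 ord0 j) - y ord0 j| < i.2.+1%:R^-1) /\
         ball (map_mx ratr i.1 : 'rV[R]_n) i.2.+1%:R^-1 `<=` U].
Proof.
move=> oU; apply/seteqP; split=> [x Ux|x [[q N] _ /= [qx]]]; last first.
  apply; apply/mx_ballE; first by rewrite invr_gt0 ltr0Sn.
  by move=> j; rewrite mxE; exact: qx.
move: (oU); rewrite openE => /(_ _ Ux)/nbhs_ballP[e /= e0 xe].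
have [N Ne] : exists N : nat, N.+1%:R^-1 < e / 2.
  have := near_infty_natSinv_lt (PosNum (divr_gt0 e0 (ltr0n R 2))).
  by move=> /filter_ex[N] /= NE; exists N.
have N0 : 0 < N.+1%:R^-1 :> R by rewrite invr_gt0 ltr0Sn.
have /choice[q qP] j : exists q : rat, `|ratr q - x ord0 j| < N.+1%:R^-1.
  have /rat_in_itvoo[q /itvP qre] : x ord0 j < x ord0 j + N.+1%:R^-1.
    by rewrite ltrDl.
  exists q; rewrite ltr_distl qre andbT (@lt_trans _ _ (x ord0 j)) ?qre//.
  by rewrite ltrBlDr ltrDl.
exists (\row_j q j, N) => //=; split=> [j|y]; first by rewrite mxE.
move=> /(mx_ballE _ _ N0) qy; apply: xe; apply/mx_ballE => // j.
rewrite (le_lt_trans (ler_distD (ratr (q j)) _ _))// (splitr e) distrC.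
apply: ltrD; first exact: (lt_trans (qP j)).
by apply: lt_trans Ne; have := qy j; rewrite !mxE.
Qed.

Lemma measurable_fun_rVP d (T : measurableType d) n (f : T -> 'rV[R]_n) :
  (forall j, measurable_fun [set: T] (fun t => f t ord0 j)) ->
  measurable_fun [set: T] (f : T -> borelRV R n).
Proof.
move=> mf; apply: (@measurability _ _ T (borelRV R n) _ _ (@open _) erefl) => _ [U oU <-].
rewrite setTI (open_rat_balls oU) preimage_bigcup.
apply: countable_bigcupT_measurable => [|[q N]]; first exact: countableP.
have [qU|qU] := pselect (ball (map_mx ratr q : 'rV[R]_n) N.+1%:R^-1 `<=` U).
  rewrite [X in measurable X](_ : _ = \bigcap_(j in [set: 'I_n])
      [set t | `|ratr (q ord0 j) - f t ord0 j| < N.+1%:R^-1]); last first.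
    by apply/seteqP; split=> t /= => [[ft _] j _|ft]; [exact: ft|split=> // j; exact: ft].
  apply: fin_bigcap_measurable => // j _.
  rewrite -[X in measurable X]setTI.
  have mg : measurable_fun [set: T] (fun t => `|ratr (q ord0 j) - f t ord0 j|).
    by apply: measurableT_comp => //; exact: measurable_funB.
  rewrite [X in _ `&` X](_ : _ = (fun t => `|ratr (q ord0 j) - f t ord0 j|) @^-1`
    [set` `]-oo, N.+1%:R^-1[ ]); last by apply/seteqP; split=> t /=; rewrite in_itv.
  exact: mg.
by rewrite [X in measurable X](_ : _ = set0)//; apply/seteqP; split=> t // [].
Qed.

End borel_measurability.

(* The n-fold product P^n on T^n, as an iterated binary product. *)
Section power_measure.
Context d (T : measurableType d) (R : realType).
Implicit Type P : probability T R.

Definition tuple_cons n (p : T * n.-tuple T) : n.+1.-tuple T :=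
  [tuple of p.1 :: p.2].

Lemma measurable_tuple_cons n : measurable_fun setT (@tuple_cons n).
Proof. exact: measurable_cons. Qed.

HB.instance Definition _ n := isMeasurableFun.Build _ _ _ _ (@tuple_cons n)
  (@measurable_tuple_cons n).

Fixpoint power_prob P n : probability (n.-tuple T) R :=
  match n with
  | 0 => \d_([tuple] : 0.-tuple T)
  | n'.+1 => distribution (P \x power_prob P n')%E (@tuple_cons n')
  end.

Lemma power_probE P n (A : 'I_n -> set T) : (forall i, measurable (A i)) ->
  power_prob P n [set t | forall i, A i (tnth t i)] = (\prod_i P (A i))%E.
Proof.
elim: n A => [|n IH] A mA /=.
  by rewrite big_ord0 diracE mem_set// => -[].
rewrite big_ord_recl -(IH (fun i => A (lift ord0 i)))//.
rewrite /distribution /pushforward.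
rewrite [X in (_ \x _)%E X](_ : _ = A ord0 `*`
    [set t : n.-tuple T | forall i, A (lift ord0 i) (tnth t i)]); last first.
  apply/seteqP; split=> [[x t]/= At|[x t]/= [Ax At] i].
    by split=> [|i]; [have := At ord0|have := At (lift ord0 i); rewrite /tuple_cons tnthS].
  by case: (unliftP ord0 i) => [j|] ->//; rewrite /tuple_cons tnthS.
apply: product_measure1E => //.
rewrite [X in measurable X](_ : _ = \bigcap_(i in [set: 'I_n])
    ((fun t : n.-tuple T => tnth t i) @^-1` A (lift ord0 i))); last first.
  by apply/seteqP; split=> t /= => [At i _|At i]; exact: At.
apply: fin_bigcap_measurable => // i _; rewrite -[X in measurable X]setTI.
exact: measurable_tnth.
Qed.

End power_measure.

(* The law of m + Z A where the row Z has i.i.d. standard normal entries,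
   i.e. N(m, A^T A); these are all the Gaussian laws with positive definite
   covariance when A ranges over the invertible matrices. *)
Section gaussian.
Context {R : realType} {n : nat}.

Definition affine_map (m : 'rV[R]_n) (A : 'M[R]_n)
    (z : n.-tuple (measurableTypeR R)) : borelRV R n :=
  m + (\row_j tnth z j) *m A.

Lemma measurable_affine_map m A : measurable_fun setT (affine_map m A).
Proof.
apply: measurable_fun_rVP => j; rewrite /affine_map.
under eq_fun do rewrite !mxE; apply: measurable_funD => //.
apply: measurable_sum => i; under eq_fun do rewrite mxE.
by apply: measurable_funM => //; exact: measurable_tnth.
Qed.

HB.instance Definition _ m A := isMeasurableFun.Build _ _ _ _ (affine_map m A)
  (@measurable_affine_map m A).

Definition gaussian m A : probability (borelRV R n) R :=
  distribution (power_prob (normal_prob (0 : R) 1) n) (affine_map m A).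

End gaussian.

(* R^d with d = \sum_m d_ m is identified with the product of the R^(d_ m)
   through the blocks submxrow x m. *)
Section marginals.
Context {R : realType} {M : nat} {d_ : 'I_M -> nat}.
Local Notation d := (\sum_(m < M) d_ m)%N.
Implicit Type P : probability (borelRV R d) R.

Definition block (m : 'I_M) (x : borelRV R d) : borelRV R (d_ m) :=
  submxrow x m.

Lemma measurable_block m : measurable_fun setT (block m).
Proof.
apply: measurable_fun_rVP => j.
rewrite [X in measurable_fun _ X](_ : _ =
    (fun x : borelRV R d => x ord0 (tagnat.Rank m j))).
  exact: measurable_coord.
by apply/funext => x; rewrite /block mxE.
Qed.

HB.instance Definition _ m := isMeasurableFun.Build _ _ _ _ (block m)
  (@measurable_block m).

Definition marginal P m : probability (borelRV R (d_ m)) R :=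
  distribution P (block m).

Definition join_blocks (t : M.-tuple (borelRV R d)) : borelRV R d :=
  \mxrow_m block m (tnth t m).

Lemma measurable_join_blocks : measurable_fun setT join_blocks.
Proof.
apply: measurable_fun_rVP => j.
rewrite [X in measurable_fun _ X](_ : _ =
    (fun x : borelRV R d => x ord0 j) \o (fun t => tnth t (tagnat.sig1 j))).
  by apply: measurableT_comp; [exact: measurable_coord|exact: measurable_tnth].
apply/funext => t; rewrite /join_blocks /block !mxE/=.
by rewrite tagnat.sig2K.
Qed.

HB.instance Definition _ := isMeasurableFun.Build _ _ _ _ join_blocks
  measurable_join_blocks.

(* The product of the marginals, built as the law of the vector whose m-th
   block is the m-th block of the m-th of M independent draws from P; see
   prod_marginalsE. *)
Definition prod_marginals P : probability (borelRV R d) R :=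
  distribution (power_prob P M) join_blocks.

Lemma prod_marginalsE P (A : forall m, set (borelRV R (d_ m))) :
  (forall m, measurable (A m)) ->
  prod_marginals P [set x | forall m, A m (submxrow x m)] =
  (\prod_m marginal P m (A m))%E.
Proof.
move=> mA; rewrite /marginal /distribution /pushforward /=.
rewrite -power_probE; last first.
  by move=> m; rewrite -[X in measurable X]setTI; exact: measurable_block.
rewrite /prod_marginals /distribution /pushforward; congr (power_prob P M _).
by apply/seteqP; split=> t /= At m; have := At m; rewrite /join_blocks mxrowK.
Qed.

End marginals.

HB.mixin Record CompleteNormedModule_isHilbert (R : realType) H
    of CompleteNormedModule R H := {
  dotp : H -> H -> R ;
  dotp_sym : forall u v, dotp u v = dotp v u ;
  dotp_linearl : forall a u v w, dotp (a *: u + v) w = a * dotp u w + dotp v w ;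
  dotp_norm : forall u, dotp u u = `|u| ^+ 2
}.

#[short(type="hilbertType")]
HB.structure Definition Hilbert (R : realType) :=
  {H of CompleteNormedModule R H & CompleteNormedModule_isHilbert R H}.

Section bochner.
Context d (T : measurableType d) (R : realType) (V : normedModType R).

Record vsimple := VSimple {
  vs_size : nat ;
  vs_set : 'I_vs_size -> set T ;
  vs_val : 'I_vs_size -> V ;
  vs_measurable : forall i, measurable (vs_set i) }.

Definition vs_fun (s : vsimple) (x : T) : V :=
  \sum_i (\1_(vs_set i) x : R) *: vs_val (v := s) i.

Definition vs_integral (P : probability T R) (s : vsimple) : V :=
  \sum_i fine (P (vs_set i)) *: vs_val (v := s) i.

Definition is_bochner (P : probability T R) (f : T -> V) (v : V) :=
  exists s : nat -> vsimple,
    [/\ {ae P, forall x, vs_fun (s n) x @[n --> \oo] --> f x},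
        (\int[P]_x `|f x - vs_fun (s n) x|%:E)%E @[n --> \oo] --> 0%E &
        vs_integral P (s n) @[n --> \oo] --> v].

(* The value is 0 when f is not Bochner integrable. *)
Definition bochner (P : probability T R) (f : T -> V) : V :=
  xget 0 [set v | is_bochner P f v].

Definition borel_measurable (f : T -> V) :=
  forall U : set V, open U -> measurable (f @^-1` U).

End bochner.

Section kernels.
Context {R : realType} {T : Type}.
Implicit Type k : T -> T -> R.

Definition is_kernel k := exists (H : hilbertType R) (phi : T -> H),
  forall x y, k x y = dotp (phi x) (phi y).

Definition bounded_kernel k := exists B, forall x y, `|k x y| <= B.

(* An element f of the space is the function rkhs_eval f; rkhs_eval is linear
   by rkhs_reproducing. The feature of x is the function k(., x). *)
Record rkhs k := Rkhs {
  rkhs_space :> hilbertType R ;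
  rkhs_eval : rkhs_space -> T -> R ;
  rkhs_eval_inj : injective rkhs_eval ;
  rkhs_feature : T -> rkhs_space ;
  rkhs_featureE : forall x, rkhs_eval (rkhs_feature x) = k ^~ x ;
  rkhs_reproducing : forall f x, rkhs_eval f x = dotp f (rkhs_feature x) }.

End kernels.

Section euclidean_kernels.
Context {R : realType} {n : nat}.
Implicit Types (k : 'rV[R]_n -> 'rV[R]_n -> R) (P Q : probability (borelRV R n) R).

Definition jointly_measurable k :=
  measurable_fun [set: borelRV R n * borelRV R n] (fun p => k p.1 p.2).

Definition continuous_kernel k :=
  continuous (fun p : 'rV[R]_n * 'rV[R]_n => k p.1 p.2).

Definition positive_definite (kappa : 'rV[R]_n -> R) :=
  forall N (c : 'I_N -> R) (x : 'I_N -> 'rV[R]_n),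
    0 <= \sum_i \sum_j c i * c j * kappa (x i - x j).

Definition translation_invariant k :=
  exists2 kappa, positive_definite kappa & forall x y, k x y = kappa (x - y).

Definition mean_embedding k (H : rkhs k) P : H :=
  bochner P (@rkhs_feature _ _ _ H : borelRV R n -> H).

(* Measures are compared on measurable sets: they are total set functions. *)
Definition is_characteristic k (H : rkhs k) := forall P Q,
  mean_embedding H P = mean_embedding H Q ->
  forall A, measurable A -> P A = Q A.

End euclidean_kernels.

Section product_kernel.
Context {R : realType} {M : nat} {d_ : 'I_M -> nat}.
Local Notation d := (\sum_(m < M) d_ m)%N.

Definition prod_kernel (k : forall m, 'rV[R]_(d_ m) -> 'rV[R]_(d_ m) -> R)
    (x y : 'rV[R]_d) : R :=
  \prod_m k m (submxrow x m) (submxrow y m).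

Definition cross_cov k (H : rkhs (prod_kernel k))
    (P : probability (borelRV R d) R) : H :=
  mean_embedding H P - mean_embedding H (prod_marginals P).

End product_kernel.

(* Main.v *)
Require Import Defs.
From HB Require Import structures.
From mathcomp Require Import all_boot all_order all_algebra.
From mathcomp Require Import all_classical all_reals all_analysis.
From mathcomp Require Import measurable_realfun.
From mathcomp Require Import ring lra.

(* Le Cam's two-point method along a path of Gaussian laws. Let [P_r] be the law
   of [z + r z_i e_j] with [z] standard normal, where the coordinates [i] and [j]
   belong to different blocks, and let [C_r] be its cross-covariance operator.

   Separation. Flipping the sign of [z_i] shows that [P_1] and [P_-1] have the
   same marginals, so [C_1 = C_-1] would force [P_1] and [P_-1] to have the same
   embedding under the product kernel. By translation invariance, a
   characteristic [k_m] separates even signed measures of nonzero mass (compare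
   a measure with its translates), so the factors [k_m] can be replaced one at a
   time by indicators; then [P_1] and [P_-1] agree on products of blocks, but
   they differ on the quadrant [x_i > 0, x_j > 0]. Hence [C_1 <> C_-1].

   Rate. Cut [[-1, 1]] into [N ~ sqrt n] pieces: by the triangle inequality some
   piece has [|C_(r + 2/N) - C_r| >= |C_1 - C_-1| / N]. Conditionally on [z_i],
   the laws [P_r] and [P_(r + e)] differ by a shift of a normal variable, so their
   Hellinger affinity is at least [1 - O(e^2)] uniformly in [r], and the affinity
   of the [n]-fold powers stays bounded away from zero. *)

Set Implicit Arguments.
Unset Strict Implicit.
Unset Printing Implicit Defensive.

Import Order.TTheory GRing.Theory Num.Theory.
Import numFieldNormedType.Exports.

Local Open Scope classical_set_scope.
Local Open Scope ring_scope.

(** * Densities and the standard normal law *)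

Section density.
Context d (T : measurableType d) (R : realType).
Variables (nu : {finite_measure set T -> \bar R})
          (mu : {sigma_finite_measure set T -> \bar R}) (f : T -> R).
Hypotheses (mf : measurable_fun setT f) (f0 : forall x, 0 <= f x)
  (nuE : forall A, measurable A -> nu A = (\int[mu]_(x in A) (f x)%:E)%E).

(** Integrals over all measurable sets determine a density up to null sets, so [f] agrees
    [mu]-almost everywhere with the Radon-Nikodym derivative of [nu], for which the change of
    variables is known. *)
Lemma ge0_integral_density (g : T -> \bar R) : measurable_fun setT g ->
  (forall x, 0 <= g x)%E ->
  (\int[nu]_x g x = \int[mu]_x (g x * (f x)%:E))%E.
Proof.
move=> mg g0.
have mEf : measurable_fun setT (EFin \o f) by exact/measurable_EFinP.
have numu : nu `<< mu.
  apply/null_content_dominatesP => A mA muA0; rewrite nuE//.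
  by apply: null_set_integral => //; exact: measurable_funTS.
rewrite -(Radon_Nikodym_SigmaFinite.change_of_variables numu)//.
apply: ae_eq_integral => //.
- apply: emeasurable_funM => //.
  exact: measurable_int (Radon_Nikodym_SigmaFinite.f_integrable numu).
- exact: emeasurable_funM.
- apply: ae_eqe_mul2l; apply: integral_ae_eq => //.
    exact: Radon_Nikodym_SigmaFinite.f_integrable.
  move=> A _ mA; rewrite -Radon_Nikodym_SigmaFinite.f_integral//.
  exact: nuE.
Qed.

End density.

Section normal.
Context {R : realType}.
Local Notation mu := (@lebesgue_measure R).
Local Notation N01 := (@normal_prob R 0 1).

Lemma integral_normal01 (g : R -> \bar R) : measurable_fun setT g ->
  (forall x, 0 <= g x)%E ->
  (\int[N01]_x g x = \int[mu]_x (g x * (normal_pdf 0 1 x)%:E))%E.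
Proof.
move=> mg g0; apply: (@ge0_integral_density _ (measurableTypeR R) R N01 mu) => //.
exact: measurable_normal_pdf.
Qed.

(** Lebesgue measure is determined by its values on half-open intervals, whose length is unchanged
    by a translation. *)
Lemma lebesgue_measure_shift (v : R) (A : set R) : measurable A ->
  pushforward mu (fun x => x + v : measurableTypeR R) A = mu A.
Proof.
move=> mA; apply/esym/lebesgue_measure_unique => //=; first exact: measurable_funD.
move=> _ _ [[a b]] _ <-; rewrite /pushforward.
rewrite [X in _ = _ X](_ : _ = [set` `]a - v, b - v] ]).
  rewrite !lebesgue_measure_itv/= !lte_fin ltrD2r -!EFinD.
  by congr (if _ then _%:E else _); ring.
by apply/seteqP; split=> x /=; rewrite !in_itv/= ltrBlDr lerBrDr.
Qed.

Lemma ge0_integral_lebesgue_shift (v : R) (g : R -> \bar R) :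
  measurable_fun setT g -> (forall x, 0 <= g x)%E ->
  (\int[mu]_x g (x + v)%R = \int[mu]_x g x)%E.
Proof.
move=> mg g0.
have mv : measurable_fun [set: measurableTypeR R]
  (fun x => x + v : measurableTypeR R) by exact: measurable_funD.
transitivity (\int[pushforward mu (fun x => (x + v)%R : measurableTypeR R)]_x g x)%E.
  by rewrite ge0_integral_pushforward.
by apply: eq_measure_integral => A mA _; exact: lebesgue_measure_shift.
Qed.

Lemma ge0_integral_lebesgue_opp (g : R -> \bar R) :
  measurable_fun setT g -> (forall x, 0 <= g x)%E ->
  (\int[mu]_x g (- x)%R = \int[mu]_x g x)%E.
Proof.
move=> mg g0.
transitivity (\int[pushforward mu ((-%R)%R : _ -> measurableTypeR R)]_x g x)%E.
  by rewrite ge0_integral_pushforward.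
by apply: eq_measure_integral => A mA _; exact: lebesgue_measureN.
Qed.

Lemma normal_pdf01 (x : R) :
  normal_pdf 0 1 x = normal_peak 1 * expR (- x ^+ 2 / 2).
Proof. by rewrite normal_pdfE ?oner_eq0// /normal_fun subr0 expr1n. Qed.

(** One-dimensional Cameron-Martin formula: the weight is the ratio of the densities of [N(v, 1)]
    and [N(0, 1)]. *)
Lemma integral_normal01_shift (v : R) (g : R -> \bar R) :
  measurable_fun setT g -> (forall x, 0 <= g x)%E ->
  (\int[N01]_x g (x + v)%R =
   \int[N01]_x (g x * (expR (v * x - v ^+ 2 / 2))%:E))%E.
Proof.
move=> mg g0.
have mv : measurable_fun [set: R] (fun x : R => x + v) by exact: measurable_funD.
have mw : measurable_fun [set: R]
    (fun x : R => (expR (v * x - v ^+ 2 / 2))%:E).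
  apply/measurable_EFinP; apply: measurableT_comp => //.
  by apply: measurable_funB => //; exact: measurable_funM.
have mp w : measurable_fun [set: R] (fun x : R => (normal_pdf 0 1 (x + w))%:E).
  apply/measurable_EFinP; apply: measurableT_comp.
    exact: measurable_normal_pdf.
  exact: measurable_funD.
rewrite !integral_normal01//; last 3 first.
- exact: emeasurable_funM.
- by move=> x; rewrite mule_ge0// lee_fin expR_ge0.
- exact: measurableT_comp.
rewrite -[LHS](@ge0_integral_lebesgue_shift (- v)); last 2 first.
- apply: emeasurable_funM; first exact: measurableT_comp.
  by have := mp 0; under eq_fun do rewrite addr0.
- by move=> x; rewrite mule_ge0// lee_fin normal_pdf_ge0.
apply: eq_integral => x _; rewrite subrK -muleA -EFinM; congr (_ * _%:E)%E.
rewrite !normal_pdf01 [in RHS]mulrCA -expRD; congr (_ * expR _).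
by field.
Qed.

Lemma integral_normal01_opp (g : R -> \bar R) :
  measurable_fun setT g -> (forall x, 0 <= g x)%E ->
  (\int[N01]_x g (- x)%R = \int[N01]_x g x)%E.
Proof.
move=> mg g0.
have mp : measurable_fun [set: R] (fun x : R => (normal_pdf 0 1 x)%:E).
  by apply/measurable_EFinP; exact: measurable_normal_pdf.
rewrite !integral_normal01//; last exact: measurableT_comp.
rewrite -[RHS]ge0_integral_lebesgue_opp; last 2 first.
- exact: emeasurable_funM.
- by move=> x; rewrite mule_ge0// lee_fin normal_pdf_ge0.
by apply: eq_integral => x _; rewrite !normal_pdf01 sqrrN.
Qed.

Lemma normal01_itv_gt0 (a b : R) : a < b -> (0 < N01 `]a, b[%classic)%E.
Proof.
move=> ab; set A := `]a, b[%classic.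
have mA : measurable A by exact: measurable_itv.
have [m m0 mP] : exists2 m : R, 0 < m &
    forall x, A x -> m <= normal_pdf 0 1 x.
  (* On the interval [|x|] is at most [|a| + |b|], and the normal density decreases in [|x|]. *)
  exists (normal_peak 1 * expR (- (`|a| + `|b|) ^+ 2 / 2)).
    by rewrite mulr_gt0 ?expR_gt0// normal_peak_gt0// oner_neq0.
  move=> x; rewrite /A/= in_itv/= => /andP[ax xb].
  rewrite normal_pdf01 ler_wpM2l ?normal_peak_ge0// ler_expR.
  rewrite ler_pM2r ?invr_gt0// lerN2 -real_normK ?num_real//.
  rewrite ler_pXn2r ?nnegrE ?addr_ge0//.
  rewrite ler_norml; apply/andP; split.
    by have := ler_norm (- a); rewrite normrN; have := normr_ge0 b; lra.
  by have := ler_norm b; have := normr_ge0 a; lra.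
apply: (@lt_le_trans _ _ (\int[mu]_(x in A) m%:E)%E).
  rewrite integral_cst// mule_gt0 ?lte_fin//= /A lebesgue_measure_itv/= lte_fin ab.
  by rewrite -EFinD lte_fin subr_gt0.
apply: ge0_le_integral => //=.
- by move=> x _; rewrite lee_fin ltW.
- by apply/measurable_EFinP/measurable_funTS; exact: measurable_normal_pdf.
Qed.

End normal.

(** * Integration against power measures *)

Section tuple_upd.
Context d (T : measurableType d).

Definition tuple_upd n (j : 'I_n) (t : n.-tuple T) (x : T) : n.-tuple T :=
  [tuple if i == j then x else tnth t i | i < n].

Lemma tnth_upd n (j i : 'I_n) t x :
  tnth (tuple_upd j t x) i = if i == j then x else tnth t i.
Proof. by rewrite tnth_mktuple. Qed.

Lemma tuple_upd_ord0 n (x y : T) (t : n.-tuple T) :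
  tuple_upd ord0 (tuple_cons (x, t)) y = tuple_cons (y, t).
Proof.
apply: eq_from_tnth => i; rewrite tnth_upd.
by case: (unliftP ord0 i) => [k|] ->; rewrite ?eqxx// !tnthS.
Qed.

Lemma tuple_upd_lift n (j : 'I_n) (x y : T) (t : n.-tuple T) :
  tuple_upd (lift ord0 j) (tuple_cons (x, t)) y = tuple_cons (x, tuple_upd j t y).
Proof.
apply: eq_from_tnth => i; rewrite tnth_upd.
case: (unliftP ord0 i) => [k|] ->; first by rewrite (inj_eq lift_inj) !tnthS tnth_upd.
by rewrite (negbTE (neq_lift _ _)).
Qed.

Lemma measurable_tuple_upd d' (S : measurableType d') n (j : 'I_n)
    (f : S -> n.-tuple T) (x : S -> T) :
  measurable_fun setT f -> measurable_fun setT x ->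
  measurable_fun setT (fun s => tuple_upd j (f s) (x s)).
Proof.
move=> mf mx; apply/measurable_fun_tnthP => i /=.
rewrite [X in measurable_fun _ X](_ : _ =
    (fun s => if i == j then x s else tnth (f s) i)); last first.
  by apply/funext => s /=; rewrite tnth_upd.
by case: (i == j) => //; exact: measurableT_comp (measurable_tnth i) mf.
Qed.

End tuple_upd.

Section power_prob_integral.
Context d (T : measurableType d) (R : realType).
Implicit Type P : probability T R.
Local Open Scope ereal_scope.

Lemma ge0_integral_power_probS P n (g : n.+1.-tuple T -> \bar R) :
  measurable_fun setT g -> (forall t, 0 <= g t) ->
  \int[power_prob P n.+1]_t g t =
  \int[P]_x \int[power_prob P n]_t g (tuple_cons (x, t)).
Proof.
move=> mg g0; rewrite /= ge0_integral_distribution// fubini_tonelli1//.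
  by apply: measurableT_comp => //; exact: measurable_tuple_cons.
by move=> p; exact: g0.
Qed.

Lemma ge0_integral_power_probS2 P n (g : n.+1.-tuple T -> \bar R) :
  measurable_fun setT g -> (forall t, 0 <= g t) ->
  \int[power_prob P n.+1]_t g t =
  \int[power_prob P n]_t \int[P]_x g (tuple_cons (x, t)).
Proof.
move=> mg g0; rewrite /= ge0_integral_distribution// fubini_tonelli2//.
  by apply: measurableT_comp => //; exact: measurable_tuple_cons.
by move=> p; exact: g0.
Qed.

Lemma measurable_tuple_consl n (x : T) :
  measurable_fun setT (fun t : n.-tuple T => tuple_cons (x, t)).
Proof. exact: measurableT_comp (@measurable_tuple_cons _ _ _) (pair1_measurable x). Qed.

Lemma measurable_tuple_consr n (t : n.-tuple T) :
  measurable_fun setT (fun x : T => tuple_cons (x, t)).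
Proof. exact: measurableT_comp (@measurable_tuple_cons _ _ _) (pair2_measurable t). Qed.

(** Lifts a one-dimensional change of variables to coordinate [j] of a power. The parameter [h t]
    stays fixed while coordinate [j] varies, so Tonelli reduces the claim to the hypothesis on [P].
    Both the Gaussian shift and the reflection are instances. *)
Lemma ge0_integral_power_prob_upd P dV (V : measurableType dV)
    (tau : V * T -> T) (w : V * T -> R) :
  measurable_fun setT tau -> measurable_fun setT w ->
  (forall p, (0 <= w p)%R) ->
  (forall v (g : T -> \bar R), measurable_fun setT g -> (forall x, 0 <= g x) ->
     \int[P]_x g (tau (v, x)) = \int[P]_x (g x * (w (v, x))%:E)) ->
  forall n (j : 'I_n) (h : n.-tuple T -> V) (g : n.-tuple T -> \bar R),
  measurable_fun setT h -> (forall t x, h (tuple_upd j t x) = h t) ->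
  measurable_fun setT g -> (forall t, 0 <= g t) ->
  \int[power_prob P n]_t g (tuple_upd j t (tau (h t, tnth t j))) =
  \int[power_prob P n]_t (g t * (w (h t, tnth t j))%:E).
Proof.
move=> mtau mw w0 tauE; elim => [[]//|n IH] j h g mh hj mg g0.
have mht : measurable_fun setT (fun t => (h t, tnth t j)).
  by apply/measurable_fun_pairP; split => //; exact: measurable_tnth.
have mL : measurable_fun setT (fun t => g (tuple_upd j t (tau (h t, tnth t j)))).
  apply: measurableT_comp => //; apply: measurable_tuple_upd => //.
  exact: measurableT_comp mtau mht.
have mR : measurable_fun setT (fun t => g t * (w (h t, tnth t j))%:E).
  apply: emeasurable_funM => //; apply/measurable_EFinP.
  exact: measurableT_comp mw mht.
have R0 t : 0 <= g t * (w (h t, tnth t j))%:E by rewrite mule_ge0// lee_fin.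
(* For [j > 0] coordinate 0 is integrated last and the induction hypothesis treats the others; for
   [j = 0] it is integrated first, with the others fixed. *)
case: (unliftP ord0 j) mL mR R0 hj {mht} => [k|] ->{j} mL mR R0 hj.
  rewrite (ge0_integral_power_probS P mL (fun t => g0 _)).
  rewrite (ge0_integral_power_probS P mR R0); apply: eq_integral => x _.
  under eq_integral do rewrite tuple_upd_lift tnthS.
  under [in RHS]eq_integral do rewrite tnthS.
  apply: (IH k (fun t => h (tuple_cons (x, t))) (fun t => g (tuple_cons (x, t)))) => //.
  - exact: measurableT_comp (measurable_tuple_consl _).
  - by move=> t y; rewrite -tuple_upd_lift hj.
  - exact: measurableT_comp (measurable_tuple_consl _).
rewrite (ge0_integral_power_probS2 P mL (fun t => g0 _)).
rewrite (ge0_integral_power_probS2 P mR R0); apply: eq_integral => t _.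
(* [point] is an arbitrary base value: here [h] does not depend on coordinate 0. *)
have hE x : h (tuple_cons (x, t)) = h (tuple_cons (point, t)).
  by rewrite -(hj _ point) tuple_upd_ord0.
under eq_integral do rewrite tuple_upd_ord0 hE.
under [in RHS]eq_integral do rewrite hE.
apply: (tauE _ (fun x => g (tuple_cons (x, t)))) => //.
exact: measurableT_comp (measurable_tuple_consr _).
Qed.

(** The likelihood ratio of independent samples is the product of the individual ratios; Tonelli
    peels off one coordinate at a time. *)
Lemma ge0_integral_power_prob_density P (Q : probability T R) (L : T -> R) :
  measurable_fun setT L -> (forall x, (0 <= L x)%R) ->
  (forall g : T -> \bar R, measurable_fun setT g -> (forall x, 0 <= g x) ->
     \int[Q]_x g x = \int[P]_x (g x * (L x)%:E)) ->
  forall n (g : n.-tuple T -> \bar R), measurable_fun setT g ->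
  (forall t, 0 <= g t) ->
  \int[power_prob Q n]_t g t =
  \int[power_prob P n]_t (g t * (\prod_i L (tnth t i))%:E).
Proof.
move=> mL L0 QL; elim => [|n IH] g mg g0.
  by apply: eq_integral => t _; rewrite big_ord0 mule1.
have mprod k : measurable_fun [set: k.-tuple T]
    (fun t => (\prod_i L (tnth t i))%:E).
  apply/measurable_EFinP; apply: measurable_prod => i _.
  exact: measurableT_comp (measurable_tnth i).
have prod0 k (t : k.-tuple T) : (0 <= \prod_i L (tnth t i))%R by exact: prodr_ge0.
have mgc x : measurable_fun setT (fun t => g (tuple_cons (x, t))).
  exact: measurableT_comp (measurable_tuple_consl _).
rewrite !ge0_integral_power_probS//; last 2 first.
- by apply: emeasurable_funM => //; exact: mprod.
- by move=> t; rewrite mule_ge0// lee_fin.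
rewrite QL; last 2 first.
- apply: (measurable_fun_fubini_tonelli_F (fun p => g (tuple_cons p))) => //.
  exact: measurableT_comp mg (@measurable_tuple_cons _ _ _).
- by move=> x; exact: integral_ge0.
apply: eq_integral => x _; rewrite IH// muleC -ge0_integralZl ?lee_fin//; last 2 first.
- by apply: emeasurable_funM => //; exact: mprod.
- by move=> t _; rewrite mule_ge0// lee_fin.
apply: eq_integral => t _; rewrite big_ord_recl EFinM muleCA; congr (_ * (_ * _%:E)).
by apply: eq_bigr => i _; rewrite tnthS.
Qed.

(** With [f] the square root of a likelihood ratio, this says that the Hellinger affinity is
    multiplicative over independent samples. *)
Lemma ge0_integral_power_prob_prod P (f : T -> R) :
  measurable_fun setT f -> (forall x, (0 <= f x)%R) ->
  forall n, \int[power_prob P n]_t (\prod_i f (tnth t i))%:E =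
            (\int[P]_x (f x)%:E) ^+ n.
Proof.
move=> mf f0; have mprod k : measurable_fun [set: k.-tuple T]
    (fun t => (\prod_i f (tnth t i))%:E).
  apply/measurable_EFinP; apply: measurable_prod => i _.
  exact: measurableT_comp (measurable_tnth i).
have prod0 k (t : k.-tuple T) : 0 <= (\prod_i f (tnth t i))%:E.
  by rewrite lee_fin; exact: prodr_ge0.
elim=> [|n IH].
  rewrite (eq_integral (cst 1)) => [|t _]; last by rewrite big_ord0.
  by rewrite integral_cst//= diracT mule1.
rewrite ge0_integral_power_probS// expeS.
have inner x : \int[power_prob P n]_t
      (\prod_i f (tnth (tuple_cons (x, t)) i))%:E =
    (f x)%:E * (\int[P]_x (f x)%:E) ^+ n.
  rewrite -IH -ge0_integralZl ?lee_fin//; last exact: mprod.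
  apply: eq_integral => t _; rewrite big_ord_recl EFinM; congr (_ * _%:E).
  by apply: eq_bigr => i _; rewrite tnthS.
under eq_integral do rewrite inner.
rewrite /= ge0_integralZr//; first exact/measurable_EFinP.
- by move=> x _; rewrite lee_fin.
- by rewrite expe_ge0// integral_ge0// => x _; rewrite lee_fin.
Qed.

End power_prob_integral.

(** * Bounded measurable functions *)

Section bounded_measurable.
Context d (T : measurableType d) (R : realType).
Implicit Types (f g : T -> R) (P : probability T R).

(** A class stable under sums and products and integrable against every probability, so that
    real-valued integrals can be manipulated without further integrability conditions. *)
Definition bounded_measurable f :=
  measurable_fun setT f /\ exists B, forall x, `|f x| <= B.

Lemma bounded_measurable_integrable P f :
  bounded_measurable f -> P.-integrable setT (EFin \o f).
Proof.
move=> [mf [B fB]]; apply: measurable_bounded_integrable => //.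
  by rewrite -ge0_fin_numE// fin_num_measure.
by exists B; split; [exact: num_real|move=> y By x _; exact: le_trans (fB x) (ltW By)].
Qed.

Lemma bounded_measurable_cst c : bounded_measurable (fun=> c).
Proof. by split => //; exists `|c|. Qed.

Lemma bounded_measurable_indic (A : set T) :
  measurable A -> bounded_measurable (\1_A : T -> R).
Proof.
move=> mA; split; first exact: measurable_indic.
by exists 1 => x; rewrite indicE; case: (_ \in _); rewrite ?normr1 ?normr0.
Qed.

Lemma bounded_measurableD f g : bounded_measurable f -> bounded_measurable g ->
  bounded_measurable (fun x => f x + g x).
Proof.
move=> [mf [B fB]] [mg [C gC]]; split; first exact: measurable_funD.
by exists (B + C) => x; rewrite (le_trans (ler_normD _ _))// lerD.
Qed.

Lemma bounded_measurableB f g : bounded_measurable f -> bounded_measurable g ->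
  bounded_measurable (fun x => f x - g x).
Proof.
move=> [mf [B fB]] [mg [C gC]]; split; first exact: measurable_funB.
by exists (B + C) => x; rewrite (le_trans (ler_normB _ _))// lerD.
Qed.

Lemma bounded_measurableM f g : bounded_measurable f -> bounded_measurable g ->
  bounded_measurable (fun x => f x * g x).
Proof.
move=> [mf [B fB]] [mg [C gC]]; split; first exact: measurable_funM.
by exists (B * C) => x; rewrite normrM ler_pM.
Qed.

Lemma bounded_measurable_prod (I : Type) (s : seq I) (p : pred I)
    (f : I -> T -> R) : (forall i, bounded_measurable (f i)) ->
  bounded_measurable (fun x => \prod_(i <- s | p i) f i x).
Proof.
move=> bf; elim: s => [|i s IH].
  under eq_fun do rewrite big_nil.
  exact: bounded_measurable_cst.
under eq_fun do rewrite big_cons.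
by case: (p i) => //; exact: bounded_measurableM.
Qed.

Lemma bounded_RintegralD P f g : bounded_measurable f -> bounded_measurable g ->
  \int[P]_x (f x + g x) = \int[P]_x f x + \int[P]_x g x.
Proof. by move=> bf bg; rewrite RintegralD//; exact: bounded_measurable_integrable. Qed.

Lemma bounded_RintegralZl P f c : bounded_measurable f ->
  \int[P]_x (c * f x) = c * \int[P]_x f x.
Proof. by move=> bf; rewrite RintegralZl//; exact: bounded_measurable_integrable. Qed.

Lemma bounded_measurable_sum (I : Type) (s : seq I) (f : I -> T -> R) :
  (forall i, bounded_measurable (f i)) ->
  bounded_measurable (fun x => \sum_(i <- s) f i x).
Proof.
move=> bf; elim: s => [|i s IH].
  under eq_fun do rewrite big_nil.
  exact: bounded_measurable_cst.
by under eq_fun do rewrite big_cons; exact: bounded_measurableD.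
Qed.

Lemma bounded_Rintegral_sum P (I : Type) (s : seq I) (f : I -> T -> R) :
  (forall i, bounded_measurable (f i)) ->
  \int[P]_x (\sum_(i <- s) f i x) = \sum_(i <- s) \int[P]_x f i x.
Proof.
move=> bf; elim: s => [|i s IH].
  under eq_Rintegral do rewrite big_nil.
  by rewrite big_nil Rintegral_cst//= mul0r.
under eq_Rintegral do rewrite big_cons.
by rewrite big_cons -IH bounded_RintegralD//; exact: bounded_measurable_sum.
Qed.

Lemma bounded_RintegralB P f g : bounded_measurable f -> bounded_measurable g ->
  \int[P]_x (f x - g x) = \int[P]_x f x - \int[P]_x g x.
Proof. by move=> bf bg; rewrite RintegralB//; exact: bounded_measurable_integrable. Qed.

Lemma EFin_bounded_Rintegral P f : bounded_measurable f ->
  (\int[P]_x f x)%:E = (\int[P]_x (f x)%:E)%E.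
Proof.
move=> bf; rewrite fineK//.
by apply: integrable_fin_num => //; exact: bounded_measurable_integrable.
Qed.

Lemma Rintegral_probability_cst P c : \int[P]_x c = c.
Proof. by rewrite Rintegral_cst//= probability_setT mulr1. Qed.

End bounded_measurable.

Lemma bounded_measurable_comp d d' (T : measurableType d) (T' : measurableType d')
    (R : realType) (f : T' -> R) (X : T -> T') :
  bounded_measurable f -> measurable_fun setT X ->
  bounded_measurable (fun x => f (X x)).
Proof.
by move=> [mf [B fB]] mX; split; [exact: measurableT_comp mf mX|exists B => x; exact: fB].
Qed.

Lemma bounded_Rintegral_distribution d d' (T : measurableType d)
    (T' : measurableType d') (R : realType) (P : probability T R)
    (X : {mfun T >-> T'}) (f : T' -> R) :
  bounded_measurable f ->
  \int[distribution P X]_x f x = \int[P]_x f (X x).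
Proof.
move=> bf; congr fine; rewrite integral_distribution//.
  by apply/measurable_EFinP; case: bf.
by apply: bounded_measurable_integrable; exact: bounded_measurable_comp.
Qed.

(** Independence for signed factors that may differ from one coordinate to the next, by Fubini and
    induction. *)
Lemma Rintegral_power_prob_prod d (T : measurableType d) (R : realType)
    (P : probability T R) n (f : 'I_n -> T -> R) :
  (forall i, bounded_measurable (f i)) ->
  \int[power_prob P n]_t (\prod_i f i (tnth t i)) = \prod_i \int[P]_x f i x.
Proof.
elim: n f => [|n IH] f bf.
  rewrite (@eq_Rintegral _ _ _ _ _ (fun=> 1)) => [|t _]; last by rewrite big_ord0.
  by rewrite Rintegral_probability_cst big_ord0.
have bft k (h : 'I_k -> T -> R) : (forall i, bounded_measurable (h i)) ->
    bounded_measurable (fun t : k.-tuple T => \prod_i h i (tnth t i)).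
  move=> bh; apply: bounded_measurable_prod => i.
  exact: bounded_measurable_comp (bh i) (measurable_tnth i).
rewrite /= bounded_Rintegral_distribution; last exact: bft.
rewrite {1}/Rintegral -integral12_prod_meas1/=; last first.
  apply: (@bounded_measurable_integrable _ _ _ _ (fun p : T * n.-tuple T =>
    \prod_i f i (tnth (tuple_cons p) i))).
  by apply: (bounded_measurable_comp (bft _ _ bf)); exact: measurable_tuple_cons.
rewrite big_ord_recl -IH// -RintegralZr//; last exact: bounded_measurable_integrable.
congr fine; apply: eq_integral => x _ /=; rewrite /fubini_F.
have btl : bounded_measurable (fun t : n.-tuple T =>
    \prod_i f (lift ord0 i) (tnth t i)).
  exact: (bft _ (fun i => f (lift ord0 i))).
rewrite -bounded_RintegralZl//.
rewrite EFin_bounded_Rintegral; last first.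
  by apply: bounded_measurableM => //; exact: bounded_measurable_cst.
apply: eq_integral => t _; rewrite big_ord_recl; congr (_ * _)%:E.
by apply: eq_bigr => i _; rewrite tnthS.
Qed.

Lemma bounded_convergence d (T : measurableType d) (R : realType)
    (P : probability T R) (u : nat -> T -> R) (v : T -> R) (B : R) :
  (forall n, measurable_fun setT (u n)) -> measurable_fun setT v ->
  (forall n x, `|u n x| <= B) -> (forall x, u n x @[n --> \oo] --> v x) ->
  \int[P]_x u n x @[n --> \oo] --> \int[P]_x v x.
Proof.
move=> mu mv uB uv; apply: fine_cvg.
have vB x : `|v x| <= B.
  have uvx : `|u n x| @[n --> \oo] --> `|v x| by apply: cvg_norm; exact: uv.
  rewrite -(cvg_lim _ uvx)//.
  by apply: limr_le; [exact: cvgP uvx|exact: nearW].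
rewrite EFin_bounded_Rintegral; last by split => //; exists B.
apply: (@dominated_cvg _ _ _ _ _ measurableT (fun n x => (u n x)%:E)
  (fun x => (v x)%:E) (fun=> B%:E)) => //.
- by move=> n; exact/measurable_EFinP.
- by move=> x _; apply: cvg_EFin; [exact: nearW|exact: uv].
- by apply: (@bounded_measurable_integrable _ _ _ P (fun=> B)); exact: bounded_measurable_cst.
- by move=> n x _ /=; rewrite lee_fin; exact: uB.
Qed.

(** * Testing two laws with close Hellinger affinity *)

Lemma measurable_sqrt (R : realType) : measurable_fun setT (@Num.sqrt R).
Proof. by apply: continuous_measurable_fun; exact: sqrt_continuous. Qed.

Lemma sqrtr_prod (R : rcfType) (I : Type) (s : seq I) (f : I -> R) :
  (forall i, 0 <= f i) ->
  Num.sqrt (\prod_(i <- s) f i) = \prod_(i <- s) Num.sqrt (f i).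
Proof.
move=> f0; elim: s => [|i s IH]; first by rewrite !big_nil sqrtr1.
by rewrite !big_cons sqrtrM// IH.
Qed.

Lemma bernoulli_ineq (R : realDomainType) (e : R) n : 0 <= e <= 1 ->
  1 - n%:R * e <= (1 - e) ^+ n.
Proof.
move=> /andP[e0 e1]; elim: n => [|n IH]; first by rewrite mul0r subr0 expr0.
rewrite exprS; apply: le_trans (ler_wpM2l _ IH); last by rewrite subr_ge0.
have ne0 : 0 <= n%:R * e ^+ 2 by rewrite mulr_ge0// sqr_ge0.
by rewrite -natr1; nra.
Qed.

Section two_point.
Context d (T : measurableType d) (R : realType).
Variables (P Q : probability T R) (L : T -> R).
Hypotheses (mL : measurable_fun setT L) (L0 : forall x, 0 <= L x)
  (QL : forall g : T -> \bar R, measurable_fun setT g -> (forall x, 0 <= g x)%E ->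
     (\int[Q]_x g x = \int[P]_x (g x * (L x)%:E))%E).

(* Weighted AM-GM: [sqrt L <= L + 1/4] on [A] and [sqrt L <= L / 4 + 1] off [A]. *)
Lemma hellinger_testing (A : set T) : measurable A ->
  (\int[P]_x (Num.sqrt (L x))%:E <=
   (1 / 2 + 3 / 4 * (fine (Q A) + fine (P (~` A))))%:E)%E.
Proof.
move=> mA.
have mAC : measurable (~` A) by exact: measurableC.
(* [g A] is the coefficient of [L], equal to 1 on [A] and to 1/4 off it; with the complement in
   place of [A] it is the constant term. *)
pose g (B : set T) (x : T) : R := 3 / 4 * \1_B x + 1 / 4.
have bg B : measurable B -> bounded_measurable (g B).
  move=> mB; apply: bounded_measurableD; last exact: bounded_measurable_cst.
  apply: bounded_measurableM; first exact: bounded_measurable_cst.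
  exact: bounded_measurable_indic.
have g0 B x : 0 <= g B x by rewrite /g; have : 0 <= (\1_B x : R) by []; lra.
have intg (mu : probability T R) B : measurable B ->
    (\int[mu]_x (g B x)%:E = (3 / 4 * fine (mu B) + 1 / 4)%:E)%E.
  move=> mB; rewrite -EFin_bounded_Rintegral; last exact: bg.
  rewrite bounded_RintegralD; last 2 first.
  - apply: bounded_measurableM; first exact: bounded_measurable_cst.
    exact: bounded_measurable_indic.
  - exact: bounded_measurable_cst.
  rewrite bounded_RintegralZl; last exact: bounded_measurable_indic.
  rewrite Rintegral_probability_cst; congr (_ * _ + _)%:E.
  by rewrite /Rintegral integral_indic// setIT.
apply: (@le_trans _ _ (\int[P]_x ((g A x)%:E * (L x)%:E + (g (~` A) x)%:E))%E).
  apply: ge0_le_integral => //.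
  - apply/measurable_EFinP; apply: measurableT_comp => //.
    exact: measurable_sqrt.
  - apply: emeasurable_funD.
      by apply: emeasurable_funM; apply/measurable_EFinP => //; case: (bg _ mA).
    by apply/measurable_EFinP; case: (bg _ mAC).
  - move=> x _; rewrite -EFinM -EFinD lee_fin.
    have := sqr_sqrtr (L0 x); have := sqrtr_ge0 (L x).
    set s := Num.sqrt (L x) => s0 <-; rewrite /g !indicE in_setC.
    by case: (x \in A) => /=; [have := sqr_ge0 (s - 1 / 2)|have := sqr_ge0 (s / 2 - 1)]; nra.
rewrite ge0_integralD//; last 4 first.
- by move=> x _; rewrite -EFinM lee_fin mulr_ge0.
- by apply: emeasurable_funM; apply/measurable_EFinP => //; case: (bg _ mA).
- by move=> x _; rewrite lee_fin.
- by apply/measurable_EFinP; case: (bg _ mAC).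
rewrite -QL; last 2 first.
- by apply/measurable_EFinP; case: (bg _ mA).
- by move=> x; rewrite lee_fin.
by rewrite !intg// -EFinD lee_fin; lra.
Qed.

End two_point.

(** The affinity of the [n]-fold powers is at least [(1 - e) ^+ n], which Bernoulli bounds below by
    [1 - n e]; the one-sample testing bound is then applied to the powers. *)
Lemma hellinger_testing_power d (T : measurableType d) (R : realType)
    (P Q : probability T R) (L : T -> R) (e : R) n (A : set (n.-tuple T)) :
  measurable_fun setT L -> (forall x, 0 <= L x) ->
  (forall g : T -> \bar R, measurable_fun setT g -> (forall x, 0 <= g x)%E ->
     (\int[Q]_x g x = \int[P]_x (g x * (L x)%:E))%E) ->
  0 <= e <= 1 -> ((1 - e)%:E <= \int[P]_x (Num.sqrt (L x))%:E)%E ->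
  measurable A ->
  1 - n%:R * e <= 1 / 2 + 3 / 4 *
    (fine (power_prob Q n A) + fine (power_prob P n (~` A))).
Proof.
move=> mL L0 QL e01 affL mA; rewrite -lee_fin.
pose Ln (t : n.-tuple T) := \prod_i L (tnth t i).
have mLn : measurable_fun setT Ln.
  by apply: measurable_prod => i _; exact: measurableT_comp mL (measurable_tnth i).
have Ln0 t : 0 <= Ln t by exact: prodr_ge0.
have QLn := @ge0_integral_power_prob_density _ _ _ _ _ _ mL L0 QL n.
apply: le_trans (@hellinger_testing _ _ _ _ _ _ mLn Ln0 QLn _ mA).
under eq_integral do rewrite /Ln sqrtr_prod//.
have msL : measurable_fun setT (fun x => Num.sqrt (L x)).
  by apply: measurableT_comp => //; exact: measurable_sqrt.
rewrite (@ge0_integral_power_prob_prod _ _ _ P (fun x => Num.sqrt (L x)))//.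
apply: (@le_trans _ _ ((1 - e)%:E ^+ n)%E).
  by rewrite -EFin_expe lee_fin bernoulli_ineq.
elim: n {A mA Ln mLn Ln0 QLn} => [|k IH]; first by rewrite !expe0.
rewrite !expeS; apply: lee_pmul => //; first by rewrite lee_fin subr_ge0; case/andP: e01.
by rewrite -EFin_expe lee_fin exprn_ge0// subr_ge0; case/andP: e01.
Qed.

(** * Hilbert spaces and Bochner integrals *)

Section hilbert.
Context {R : realType} {H : hilbertType R}.
Implicit Types u v w : H.

Lemma dotpDl u v w : dotp (u + v) w = dotp u w + dotp v w.
Proof. by rewrite -[u]scale1r dotp_linearl mul1r scale1r. Qed.

Lemma dot0p w : dotp 0 w = 0.
Proof. by apply: (addIr (dotp 0 w)); rewrite -dotpDl !add0r. Qed.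

Lemma dotpZl a u w : dotp (a *: u) w = a * dotp u w.
Proof. by rewrite -[a *: u]addr0 dotp_linearl dot0p addr0. Qed.

Lemma dotpNl u w : dotp (- u) w = - dotp u w.
Proof. by rewrite -scaleN1r dotpZl mulN1r. Qed.

Lemma dotpBl u v w : dotp (u - v) w = dotp u w - dotp v w.
Proof. by rewrite dotpDl dotpNl. Qed.

Lemma dotp_suml (I : Type) (s : seq I) (p : pred I) (F : I -> H) w :
  dotp (\sum_(i <- s | p i) F i) w = \sum_(i <- s | p i) dotp (F i) w.
Proof. exact: (big_morph (dotp^~ w) (fun u v => dotpDl u v w) (dot0p w)). Qed.

Lemma normB_sqr u v : `|u - v| ^+ 2 = `|u| ^+ 2 - 2 * dotp u v + `|v| ^+ 2.
Proof.
rewrite -!dotp_norm dotpBl (dotp_sym u) (dotp_sym v) !dotpBl (dotp_sym v u).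
by ring.
Qed.

Lemma cauchy_schwarz u v : `|dotp u v| <= `|u| * `|v|.
Proof.
have main u' v' : dotp u' v' <= `|u'| * `|v'|.
  have [->|u0] := eqVneq u' 0; first by rewrite dot0p normr0 mul0r.
  have [->|v0] := eqVneq v' 0; first by rewrite dotp_sym dot0p normr0 mulr0.
  (* The square expands to [2 |u'| |v'| (|u'| |v'| - dotp u' v')]. *)
  have := sqr_ge0 (`| `|v'| *: u' - `|u'| *: v'|).
  rewrite normB_sqr !normrZ !normr_id dotpZl dotp_sym dotpZl dotp_sym => h.
  have p0 : 0 < `|u'| * `|v'| by rewrite mulr_gt0 ?normr_gt0.
  rewrite -subr_ge0 -(pmulr_rge0 _ p0); move: h.
  by move: (dotp u' v') => q; nra.
rewrite ler_norml main andbT lerNl -dotpNl.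
by have := main (- u) v; rewrite normrN.
Qed.

End hilbert.

(** * Bochner integrals of bounded maps into a Hilbert space *)

Section bochner_hilbert.
Context d (T : measurableType d) (R : realType) (V : hilbertType R).
Variables (P : probability T R) (f : T -> V).
Hypotheses (mf : forall w, measurable_fun setT (fun x => `|f x - w|))
  (bf : exists B, forall x, `|f x| <= B).
Implicit Types (s : vsimple T V) (v w : V).

Let norm_measurable : measurable_fun setT (fun x => `|f x|).
Proof. by have := mf 0; under eq_fun do rewrite subr0. Qed.

(** By polarization the inner product is a combination of squared distances, so measurability of the
    distances to fixed vectors suffices. *)
Lemma bounded_measurable_dotp w : bounded_measurable (fun x => dotp (f x) w).
Proof.
split; last first.
  case: bf => B fB; exists (B * `|w|) => x.
  by rewrite (le_trans (cauchy_schwarz _ _))// ler_wpM2r.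
have -> : (fun x => dotp (f x) w) =
    (fun x => 2^-1 * (`|f x| ^+ 2 + `|w| ^+ 2 - `|f x - w| ^+ 2)).
  by apply/funext => x; rewrite normB_sqr; field.
apply: measurable_funM => //; apply: measurable_funB.
  apply: measurable_funD => //; exact: measurable_funX.
exact: measurable_funX.
Qed.

Lemma vs_fun_bounded s : exists B, forall x, `|vs_fun s x| <= B.
Proof.
exists (\sum_i `|vs_val (v := s) i|) => x.
rewrite (le_trans (ler_norm_sum _ _ _))// ler_sum// => i _.
by rewrite normrZ ler_piMl// indicE; case: (_ \in _); rewrite ?normr1 ?normr0.
Qed.

(** On and off the first set, the first term of the sum only moves the base point [w]; hence the
    induction over all [w]. The sets may overlap. *)
Lemma measurable_sub_sum n (A : 'I_n -> set T) (a : 'I_n -> V) w :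
  (forall i, measurable (A i)) ->
  measurable_fun setT
    (fun x => `|f x - (w + \sum_i (\1_(A i) x : R) *: a i)|).
Proof.
elim: n A a w => [|n IH] A a w mA.
  by under eq_fun do rewrite big_ord0 addr0; exact: mf.
rewrite [X in measurable_fun _ X](_ : _ = fun x => if x \in A ord0
    then `|f x - (w + a ord0 +
             \sum_i (\1_(A (lift ord0 i)) x : R) *: a (lift ord0 i))|
    else `|f x - (w + \sum_i (\1_(A (lift ord0 i)) x : R) *: a (lift ord0 i))|).
  apply: measurable_fun_ifT.
  - apply: (measurable_fun_bool true) => //; rewrite setTI.
    rewrite [X in measurable X](_ : _ = A ord0)//.
    by apply/seteqP; split=> x /=; [move/set_mem|move/mem_set].
  - exact: IH.
  - exact: IH.
apply/funext => x; rewrite big_ord_recl indicE.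
by case: (x \in A ord0); rewrite ?scale1r ?scale0r ?add0r ?addrA.
Qed.

Lemma bounded_measurable_sub_vs s :
  bounded_measurable (fun x => `|f x - vs_fun s x|).
Proof.
split.
  have := measurable_sub_sum (vs_val (v := s)) 0 (vs_measurable (v := s)).
  by under eq_fun do rewrite add0r.
case: bf => B fB; have [C sC] := vs_fun_bounded s.
by exists (B + C) => x; rewrite normr_id (le_trans (ler_normB _ _))// lerD.
Qed.

Lemma dotp_vs_integral s w :
  dotp (vs_integral P s) w = \int[P]_x dotp (vs_fun s x) w.
Proof.
rewrite /vs_integral dotp_suml.
under eq_Rintegral do rewrite /vs_fun dotp_suml.
have bi i : bounded_measurable
    (fun x => dotp ((\1_(vs_set (v := s) i) x : R) *: vs_val (v := s) i) w).
  under eq_fun do rewrite dotpZl; apply: bounded_measurableM.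
    by apply: bounded_measurable_indic; exact: vs_measurable.
  exact: bounded_measurable_cst.
rewrite bounded_Rintegral_sum//; apply: eq_bigr => i _.
under eq_Rintegral do rewrite dotpZl mulrC.
have mi := vs_measurable (v := s) i.
rewrite bounded_RintegralZl; last exact: bounded_measurable_indic.
by rewrite dotpZl mulrC /Rintegral integral_indic// setIT.
Qed.

Lemma bounded_measurable_dotp_vs s w :
  bounded_measurable (fun x => dotp (vs_fun s x) w).
Proof.
under eq_fun do rewrite dotp_suml.
apply: bounded_measurable_sum => i.
under eq_fun do rewrite dotpZl; apply: bounded_measurableM.
  by apply: bounded_measurable_indic; exact: vs_measurable.
exact: bounded_measurable_cst.
Qed.

(** Cauchy-Schwarz under the integral. The estimate serves twice: to identify the limit of the
    simple integrals, and to show that they form a Cauchy sequence. *)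
Lemma dotp_vs_integral_sub s w :
  `|dotp (vs_integral P s) w - \int[P]_x dotp (f x) w| <=
  \int[P]_x `|f x - vs_fun s x| * `|w|.
Proof.
have bs := bounded_measurable_dotp_vs s w.
have bfw := bounded_measurable_dotp w.
rewrite dotp_vs_integral distrC -bounded_RintegralB//.
have bd : bounded_measurable (fun x => dotp (f x) w - dotp (vs_fun s x) w).
  exact: bounded_measurableB.
apply: le_trans (le_normr_Rintegral _ _) _ => //.
  exact: bounded_measurable_integrable.
rewrite mulrC -bounded_RintegralZl; last exact: bounded_measurable_sub_vs.
apply: le_Rintegral => //.
- apply: (@bounded_measurable_integrable _ _ _ P
    (fun x => `|dotp (f x) w - dotp (vs_fun s x) w|)).
  split; first by apply: measurableT_comp => //; case: bd.
  by case: bd => _ [B dB]; exists B => x; rewrite normr_id.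
- apply: (@bounded_measurable_integrable _ _ _ P (fun x => `|w| * `|f x - vs_fun s x|)).
  apply: bounded_measurableM; first exact: bounded_measurable_cst.
  exact: bounded_measurable_sub_vs.
- by move=> x _; rewrite -dotpBl mulrC cauchy_schwarz.
Qed.

Lemma is_bochner_dotp v : is_bochner P f v ->
  forall w, dotp v w = \int[P]_x dotp (f x) w.
Proof.
move=> [s [_ fs Is]] w.
have {}fs : \int[P]_x `|f x - vs_fun (s n) x| @[n --> \oo] --> 0.
  exact: (fine_cvg fs).
apply/eqP; rewrite -subr_eq0 -normr_eq0 eq_le normr_ge0 andbT.
suff : `|dotp (vs_integral P (s n)) w - \int[P]_x dotp (f x) w| @[n --> \oo]
    --> `|dotp v w - \int[P]_x dotp (f x) w|.
  move=> h; have g0 : \int[P]_x `|f x - vs_fun (s n) x| * `|w| @[n --> \oo] --> 0.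
    by rewrite -(mul0r `|w|); apply: cvgM => //; exact: cvg_cst.
  apply: (ler_cvg_to h g0); apply: nearW => n.
  exact: dotp_vs_integral_sub.
apply: cvg_norm; apply: cvgB; last exact: cvg_cst.
apply/cvgrPdist_lt => e e0.
have w1 : 0 < `|w| + 1 by rewrite ltr_wpDl.
have e1 : 0 < e / (`|w| + 1) by rewrite divr_gt0.
move/cvgrPdist_lt : Is => /(_ _ e1); apply: filterS => n vn.
rewrite -dotpBl (le_lt_trans (cauchy_schwarz _ _))//.
rewrite -[ltRHS](divfK (lt0r_neq0 w1)).
by apply: (@le_lt_trans _ _ (`|v - vs_integral P (s n)| * (`|w| + 1)));
  rewrite ?ler_wpM2l ?lerDl// ltr_pM2r.
Qed.

(** The [N]-th simple function sends [x] to the point nearest to [f x] among [q 0, ..., q N]. Its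
    distance to [f] tends to 0 pointwise and boundedly, hence in mean, and completeness yields the
    limit of the integrals. *)
Lemma is_bochner_exists : (exists q : nat -> V,
    forall x e, 0 < e -> exists i, `|f x - q i| < e) ->
  exists v, is_bochner P f v.
Proof.
move=> [q qP].
pose D i x := `|f x - q i|.
have mD i : measurable_fun setT (D i) by exact: mf.
(* [E N i] says that [q i] is a nearest point; [A N i] breaks ties by the smallest index, which
   makes the sets a partition. *)
pose E N i := [set x | forall j : 'I_N.+1, D i x <= D j x].
pose A N (i : 'I_N.+1) := [set x | E N i x /\ forall j : 'I_N.+1, (j < i)%N -> ~ E N j x].
have mE N i : measurable (E N i).
  rewrite [X in measurable X](_ : _ = \bigcap_(j in [set: 'I_N.+1])
      [set x | D i x <= D j x]); last first.
    by apply/seteqP; split=> x /= h j => [_|]; exact: h.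
  apply: fin_bigcap_measurable => // j _.
  by rewrite -[X in measurable X]setTI; exact: measurable_fun_le.
have mA N i : measurable (A N i).
  rewrite [X in measurable X](_ : _ = E N i `&`
      \bigcap_(j in [set j : 'I_N.+1 | (j < i)%N]) ~` E N j); last first.
    by apply/seteqP; split=> x /= [Ex h]; split => // j; exact: h.
  apply: measurableI => //; apply: fin_bigcap_measurable => // j _.
  exact: measurableC.
pose s N : vsimple T V := VSimple (fun i : 'I_N.+1 => q i) (mA N).
have sE N x : exists i : 'I_N.+1, vs_fun (s N) x = q i /\ E N i x.
  have exE : exists n, (n < N.+1)%N && `[< E N n x >].
    case: (@arg_minP _ R 'I_N.+1 ord0 xpredT (fun i => D i x) isT) => i _ iP.
    by exists i; rewrite ltn_ord/=; apply/asboolP => j; exact: iP.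
  case: (ex_minnP exE) => n /andP[nN /asboolP En] nmin.
  pose i := Ordinal nN; exists i; split => //.
  have Ai : A N i x.
    split=> // j ji Ej; move: (nmin j); rewrite ltn_ord/= leqNgt.
    by rewrite -[(n)%N]/(nat_of_ord i) ji => /(_ (asboolT Ej)).
  rewrite /vs_fun/= (bigD1 i)//= indicE mem_set// scale1r big1 ?addr0// => j ji.
  rewrite indicE memNset ?scale0r// => -[Ej jmin].
  have [lij|lji|eij] := ltngtP i j.
  - exact: (jmin i).
  - by case: Ai => _ /(_ j lji).
  - by move: ji; rewrite (ord_inj eij) eqxx.
have sD N x (j : nat) : (j <= N)%N -> `|f x - vs_fun (s N) x| <= D j x.
  move=> jN; have [i [-> Ei]] := sE N x.
  by apply: (Ei (Ordinal (_ : (j < N.+1)%N))); rewrite ltnS.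
have cvgs x : `|f x - vs_fun (s N) x| @[N --> \oo] --> 0.
  apply/cvgr0Pnorm_lt => e e0; have [i ie] := qP x e e0.
  near=> N; rewrite normr_id; apply: le_lt_trans ie; apply: sD.
  by near: N; exact: nbhs_infty_ge.
have [B fB] := bf.
(* The nearest point is no farther than [q 0], which gives a bound common to all stages. *)
have sB N x : `| `|f x - vs_fun (s N) x| | <= B + `|q 0%N|.
  by rewrite normr_id (le_trans (sD N x 0%N _))// (le_trans (ler_normB _ _))// lerD2r.
have Ecvg : \int[P]_x `|f x - vs_fun (s N) x| @[N --> \oo] --> 0.
  rewrite -[X in _ --> X](Rintegral_probability_cst P 0).
  by apply: (bounded_convergence _ _ sB) => // N; case: (bounded_measurable_sub_vs (s N)).
have Icvg : cvg (vs_integral P (s N) @[N --> \oo]).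
  apply: cauchy_cvg; apply: cauchy_exP => e e0.
  have e2 : 0 < e / 2 by rewrite divr_gt0.
  move/cvgr0Pnorm_lt : Ecvg => /(_ _ e2)[N0 _ N0P].
  exists (vs_integral P (s N0)); exists N0 => // N /= NN0.
  rewrite -ball_normE/=; set u := _ - _.
  have [->|u0] := eqVneq u 0; first by rewrite normr0.
  (* Tested against [u] itself, both simple integrals are close to the integral of [dotp (f x) u];
     dividing by [|u|] leaves the sum of the two mean errors. *)
  have : dotp u u <= (\int[P]_x `|f x - vs_fun (s N0) x| +
                      \int[P]_x `|f x - vs_fun (s N) x|) * `|u|.
    rewrite {1}/u dotpBl mulrDl.
    have := dotp_vs_integral_sub (s N0) u; have := dotp_vs_integral_sub (s N) u.
    by rewrite !ler_norml => /andP[h1 _] /andP[_ h2]; lra.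
  rewrite dotp_norm expr2 ler_pM2r ?normr_gt0// => /le_lt_trans; apply.
  have := N0P _ (leqnn N0); have := N0P _ NN0.
  rewrite !ger0_norm; [|by apply: Rintegral_ge0|by apply: Rintegral_ge0].
  by lra.
exists (lim (vs_integral P (s N) @[N --> \oo])), s; split => //.
- apply: aeW => x; apply/cvgrPdist_lt => e e0.
  by move/cvgr0Pnorm_lt : (cvgs x) => /(_ _ e0); apply: filterS => N; rewrite normr_id.
- rewrite [X in X @ _ --> _](_ : _ = fun N =>
      (\int[P]_x `|f x - vs_fun (s N) x|)%:E).
    by apply: cvg_EFin => //; exact: nearW.
  apply/funext => N; rewrite EFin_bounded_Rintegral//.
  exact: bounded_measurable_sub_vs.
Unshelve. all: end_near. Qed.

(** Existence excludes the default value of [bochner], so the chosen vector is a genuine integral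
    and commutes with inner products. *)
Lemma dotp_bochner : (exists q : nat -> V,
    forall x e, 0 < e -> exists i, `|f x - q i| < e) ->
  forall w, dotp (bochner P f) w = \int[P]_x dotp (f x) w.
Proof.
move=> /is_bochner_exists[v fv]; apply: is_bochner_dotp.
by rewrite /bochner; exact: (xgetPex 0 (ex_intro _ v fv)).
Qed.

End bochner_hilbert.

(** * Mean embeddings of continuous bounded kernels *)

Section borelRV_facts.
Context {R : realType} {n : nat}.

Lemma continuous_measurable_borelRV (g : 'rV[R]_n -> R) :
  continuous g -> measurable_fun [set: borelRV R n] g.
Proof.
move=> cg; apply: (measurability _ (RGenOpens.measurableE R)) => _ [_ [a [b ->]] <-].
rewrite setTI; apply: measurable_open_rV.
by apply: open_comp; [move=> x _; exact: cg|exact: interval_open].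
Qed.

Lemma exists_dense_seq : exists q : nat -> 'rV[R]_n,
  forall (U : set 'rV[R]_n) x, open U -> U x -> exists i, U (q i).
Proof.
(* Rational vectors are enumerated by their codes; a number that codes no vector is sent to 0. *)
exists (fun i => map_mx ratr (odflt 0 (unpickle i : option 'rV[rat]_n))).
move=> U x oU; rewrite {1}(open_rat_balls oU) => -[[p N] _ /= [_ pU]].
exists (pickle p); rewrite pickleK/=; apply: pU; apply: ballxx.
by rewrite invr_gt0.
Qed.

End borelRV_facts.

Section mean_embedding_facts.
Context {R : realType} {n : nat}.
Variables (k : 'rV[R]_n -> 'rV[R]_n -> R) (H : rkhs k).
Hypotheses (ck : continuous_kernel k) (bk : bounded_kernel k).
Local Notation phi := (@rkhs_feature _ _ _ H).

Lemma rkhs_kernelE x y : k x y = dotp (phi y) (phi x).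
Proof. by rewrite -rkhs_reproducing rkhs_featureE. Qed.

Lemma rkhs_kernel_sym x y : k x y = k y x.
Proof. by rewrite !rkhs_kernelE dotp_sym. Qed.

(** The squared feature distance is [k x x - 2 k y x + k y y], which tends to 0 by joint continuity
    of the kernel. *)
Lemma feature_continuous : continuous (phi : 'rV[R]_n -> H).
Proof.
move=> x; apply/(@cvgrPdist_lt _ H _ (nbhs x) (nbhs_filter x)) => e e0.
have dE y : `|phi x - phi y| ^+ 2 = k x x - 2 * k y x + k y y.
  by rewrite normB_sqr -!dotp_norm -!rkhs_kernelE.
have diag : k y y @[y --> x] --> k x x.
  exact: (@continuous2_cvg _ _ _ _ (nbhs x) (nbhs_filter x) id id k x x
    (@ck (x, x)) cvg_id cvg_id).
have side : k y x @[y --> x] --> k x x.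
  exact: (@continuous2_cvg _ _ _ _ (nbhs x) (nbhs_filter x) id (fun=> x) k x x
    (@ck (x, x)) cvg_id (cvg_cst x)).
(* One third of [e ^+ 2] goes to the diagonal term and two thirds to the cross term, which is
   counted twice. *)
have d0 : 0 < e ^+ 2 / 3 by rewrite divr_gt0// exprn_gt0.
move/(@cvgrPdist_lt _ _ _ (nbhs x) (nbhs_filter x)) : diag => /(_ _ d0) near1.
move/(@cvgrPdist_lt _ _ _ (nbhs x) (nbhs_filter x)) : side => /(_ _ d0) near2.
apply: (@filterS2 _ (nbhs x) (nbhs_filter x) _ _ _ _ near1 near2) => y.
rewrite ltr_norml => /andP[h1 _]; rewrite ltr_norml => /andP[_ h2].
by rewrite -(@ltr_pXn2r _ 2)//; [rewrite dE; lra|rewrite nnegrE|rewrite nnegrE ltW].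
Qed.

Lemma feature_norm_measurable (w : H) :
  measurable_fun [set: borelRV R n] (fun x => `|phi x - w|).
Proof.
apply: continuous_measurable_borelRV => x.
apply: (@continuous_comp _ _ _ phi (fun z : H => `|z - w|)).
  exact: feature_continuous.
by apply: cvg_norm; apply: cvgB; [exact: cvg_id|exact: cvg_cst].
Qed.

Lemma feature_bounded : exists B, forall x, `|phi x| <= B.
Proof.
(* The squared norm [k x x] is at most [B], and [B <= (B + 1) ^+ 2]; no square root has to be
   taken. *)
case: bk => B kB; exists (B + 1) => x.
have B0 : 0 <= B by exact: le_trans (kB x x).
rewrite -(@ler_pXn2r _ 2)// ?nnegrE ?addr_ge0//.
rewrite -dotp_norm -rkhs_kernelE (le_trans (ler_norm _))// (le_trans (kB _ _))//.
nra.
Qed.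

Lemma feature_separable : exists q : nat -> H,
  forall x e, 0 < e -> exists i, `|phi x - q i| < e.
Proof.
have [q qP] := @exists_dense_seq R n; exists (fun i => phi (q i)) => x e e0.
pose U := (phi : 'rV[R]_n -> H) @^-1` ball (phi x) e.
have oU : open U by apply: open_comp; [move=> y _; exact: feature_continuous|exact: ball_open].
have [i Ui] := qP U x oU (ballxx _ e0).
by exists i; move: Ui; rewrite /U/= -ball_normE.
Qed.

Lemma dotp_mean_embedding P w :
  dotp (mean_embedding H P) w = \int[P]_x dotp (phi x) w.
Proof.
apply: dotp_bochner; [exact: feature_norm_measurable|exact: feature_bounded|].
exact: feature_separable.
Qed.

Lemma bounded_measurable_kernel a :
  bounded_measurable (fun x : borelRV R n => k x a).
Proof.
under eq_fun do rewrite rkhs_kernel_sym rkhs_kernelE.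
apply: bounded_measurable_dotp; [exact: feature_norm_measurable|exact: feature_bounded].
Qed.

(** The value of an embedding at [a] is its inner product with the feature of [a], and an element of
    the space is determined by its values. Later arguments use only these scalar integrals. *)
Lemma mean_embedding_eq P Q :
  mean_embedding H P = mean_embedding H Q <->
  forall a, \int[P]_x k x a = \int[Q]_x k x a.
Proof.
have E (mu : probability (borelRV R n) R) a :
    dotp (mean_embedding H mu) (phi a) = \int[mu]_x k x a.
  rewrite dotp_mean_embedding; apply: eq_Rintegral => x _.
  by rewrite rkhs_kernel_sym rkhs_kernelE.
split=> [PQ a|PQ]; first by rewrite -!E PQ.
apply: (@rkhs_eval_inj _ _ _ H); apply/funext => a.
by rewrite !rkhs_reproducing !E.
Qed.

End mean_embedding_facts.

(** * Injectivity of weighted embeddings *)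

Section density_measure.
Context d (T : measurableType d) (R : realType).
Variables (P : probability T R) (f : T -> R).
Hypotheses (bf : bounded_measurable f) (f0 : forall x, 0 <= f x).

Definition density_measure (A : set T) : \bar R := (\int[P]_(x in A) (f x)%:E)%E.

Let mEf : measurable_fun setT (EFin \o f).
Proof. by apply/measurable_EFinP; case: bf. Qed.

Let density0 : density_measure set0 = 0%E.
Proof. exact: integral_set0. Qed.

Let density_ge0 A : (0 <= density_measure A)%E.
Proof. by apply: integral_ge0 => x _; rewrite lee_fin. Qed.

Let density_sigma_additive : semi_sigma_additive density_measure.
Proof.
move=> F mF tF mUF; rewrite /density_measure ge0_integral_bigcup//; last 2 first.
- exact: measurable_funTS.
- by move=> x _; rewrite lee_fin.
by apply: is_cvg_ereal_nneg_natsum_cond => n _ _; exact: density_ge0.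
Qed.

HB.instance Definition _ := isMeasure.Build _ _ _ density_measure
  density0 density_ge0 density_sigma_additive.

Let density_fin : fin_num_fun density_measure.
Proof.
move=> A mA; apply: integrable_fin_num => //.
apply: (integrableS measurableT) => //.
exact: bounded_measurable_integrable.
Qed.

HB.instance Definition _ := Measure_isFinite.Build _ _ _ density_measure density_fin.

Lemma ge0_integral_density_measure (g : T -> \bar R) : measurable_fun setT g ->
  (forall x, 0 <= g x)%E ->
  (\int[density_measure]_x g x = \int[P]_x (g x * (f x)%:E))%E.
Proof. by apply: ge0_integral_density => //; case: bf. Qed.

End density_measure.

(** The measure is the image under [X] of the measure with density [f]; only its action on
    nonnegative functions is kept. *)
Lemma exists_weighted_law d d' (T : measurableType d) (T' : measurableType d')
    (R : realType) (P : probability T R) (X : T -> T') (f : T -> R) :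
  measurable_fun setT X -> bounded_measurable f -> (forall x, 0 <= f x) ->
  exists m : {measure set T' -> \bar R},
  forall g : T' -> \bar R, measurable_fun setT g -> (forall y, 0 <= g y)%E ->
  (\int[m]_y g y = \int[P]_x (g (X x) * (f x)%:E))%E.
Proof.
move=> mX bf f0.
unshelve refine (ex_intro _
  (pushforward (density_measure P f) X : {measure set T' -> \bar R}) _) => //.
move=> g mg g0; rewrite ge0_integral_pushforward//.
rewrite ge0_integral_density_measure// => [|x]; last exact: g0.
exact: measurableT_comp.
Qed.

(** The law is the sum of four weighted images: under [P], [X] has weight [a] and [Y] weight [b];
    under [Q] the weights are exchanged. Since [a + b = 1 / 2], each of [P] and [Q] contributes mass
    1/2. *)
Lemma exists_mixture d d' (T : measurableType d) (T' : measurableType d')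
    (R : realType) (P Q : probability T R) (X Y : T -> T') (a b : T -> R) :
  measurable_fun setT X -> measurable_fun setT Y ->
  bounded_measurable a -> bounded_measurable b ->
  (forall x, 0 <= a x) -> (forall x, 0 <= b x) ->
  (forall x, a x + b x = 1 / 2) ->
  exists nu : probability T' R,
  forall g : T' -> R, bounded_measurable g ->
  \int[nu]_y g y = \int[P]_x (g (X x) * a x + g (Y x) * b x) +
                   \int[Q]_x (g (X x) * b x + g (Y x) * a x).
Proof.
move=> mX mY ba bb a0 b0 ab.
have [m1 m1E] := exists_weighted_law P mX ba a0.
have [m2 m2E] := exists_weighted_law P mY bb b0.
have [m3 m3E] := exists_weighted_law Q mX bb b0.
have [m4 m4E] := exists_weighted_law Q mY ba a0.
pose m : {measure set T' -> \bar R} :=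
  measure_add (measure_add m1 m2) (measure_add m3 m4).
have bgf (g : T' -> R) (Z : T -> T') f : bounded_measurable g ->
    measurable_fun setT Z -> bounded_measurable f ->
    bounded_measurable (fun x => g (Z x) * f x).
  move=> bg mZ bf; apply: bounded_measurableM => //.
  exact: bounded_measurable_comp bg mZ.
have mE (g : T' -> R) : bounded_measurable g -> (forall y, 0 <= g y) ->
    (\int[m]_y (g y)%:E = (\int[P]_x (g (X x) * a x + g (Y x) * b x) +
                   \int[Q]_x (g (X x) * b x + g (Y x) * a x))%R%:E)%E.
  move=> bg g0; have mg : measurable_fun setT (EFin \o g).
    by apply/measurable_EFinP; case: bg.
  rewrite ge0_integral_measure_add//; last by move=> y _; rewrite lee_fin.
  rewrite !ge0_integral_measure_add//; try by move=> y _; rewrite lee_fin.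
  rewrite m1E ?m2E ?m3E ?m4E//; try by move=> y; rewrite lee_fin.
  rewrite EFinD !bounded_RintegralD; try exact: bgf.
  by rewrite !EFinD !EFin_bounded_Rintegral; try exact: bgf.
have m1T : m setT = 1%E.
  rewrite -[LHS]mul1e -(integral_cst m measurableT 1).
  rewrite mE; [|exact: bounded_measurable_cst|by []].
  under eq_Rintegral do rewrite !mul1r ab.
  under [X in _ + X]eq_Rintegral do rewrite !mul1r addrC ab.
  by rewrite !Rintegral_probability_cst; congr _%:E; field.
pose nu : probability T' R := HB.pack (Measure.sort m) (Measure.class m)
  (Measure_isProbability.Build _ _ _ m m1T).
exists nu => g bg.
have [mg [B gB]] := bg.
(* [mE] covers nonnegative functions only, so [g] is raised by its bound; each half of the mixture
   then gains [B / 2], which cancels against [B]. *)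
pose h y := g y + B.
have bh : bounded_measurable h.
  by apply: bounded_measurableD => //; exact: bounded_measurable_cst.
have h0 y : 0 <= h y by have := gB y; rewrite ler_norml /h => /andP[]; lra.
have nuh : \int[nu]_y h y = \int[P]_x (h (X x) * a x + h (Y x) * b x) +
                   \int[Q]_x (h (X x) * b x + h (Y x) * a x).
  by rewrite /Rintegral [X in fine X](mE _ bh h0).
move: nuh; rewrite bounded_RintegralD//; last exact: bounded_measurable_cst.
rewrite Rintegral_probability_cst.
rewrite [X in _ = X + _ -> _](_ : _ =
    \int[P]_x (g (X x) * a x + g (Y x) * b x) + B / 2); last first.
  rewrite -[B / 2](Rintegral_probability_cst P) -bounded_RintegralD.
  - by apply: eq_Rintegral => x _; rewrite /h -[B / 2]mulr1; have := ab x; nra.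
  - by apply: bounded_measurableD; exact: bgf.
  - exact: bounded_measurable_cst.
rewrite [X in _ = _ + X -> _](_ : _ =
    \int[Q]_x (g (X x) * b x + g (Y x) * a x) + B / 2); last first.
  rewrite -[B / 2](Rintegral_probability_cst Q) -bounded_RintegralD.
  - by apply: eq_Rintegral => x _; rewrite /h -[B / 2]mulr1; have := ab x; nra.
  - by apply: bounded_measurableD; exact: bgf.
  - exact: bounded_measurable_cst.
by move=> E; lra.
Qed.

(** * Characteristic translation-invariant kernels and weighted laws *)

Section weighted_injectivity.
Context {R : realType} {n : nat}.
Variables (k : 'rV[R]_n -> 'rV[R]_n -> R) (H : rkhs k).
Hypotheses (n0 : (0 < n)%N) (ck : continuous_kernel k) (bk : bounded_kernel k)
  (tk : translation_invariant k) (chk : is_characteristic H).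
Context d (T : measurableType d) (P Q : probability T R)
  (X : T -> borelRV R n) (W : T -> R).
Hypotheses (mX : measurable_fun setT X) (bW : bounded_measurable W).

Lemma measurable_shift_borelRV (t : 'rV[R]_n) :
  measurable_fun setT (fun x => X x + t : borelRV R n).
Proof.
apply: measurable_fun_rVP => j; under eq_fun do rewrite mxE.
by apply: measurable_funD => //; exact: measurableT_comp (measurable_coord j) mX.
Qed.

(* The difference of the two sides is proportional to [nu1 A - nu2 A] for two
   mixtures [nu1], [nu2] of weighted laws of [X] and [X + t] that have the same
   mean embedding; adding the shifted laws makes both total masses equal to 1. *)
Lemma weighted_shift_invariance :
  (forall a, \int[P]_x (W x * k (X x) a) = \int[Q]_x (W x * k (X x) a)) ->
  forall (t : 'rV[R]_n) (A : set (borelRV R n)), measurable A ->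
  \int[P]_x (W x * \1_A (X x)) - \int[P]_x (W x * \1_A (X x + t)) =
  \int[Q]_x (W x * \1_A (X x)) - \int[Q]_x (W x * \1_A (X x + t)).
Proof.
move=> PQ t.
have [mW [C0 WC0]] := bW.
pose C := `|C0| + 1.
have C_gt0 : 0 < C by rewrite ltr_wpDl.
have WC x : `|W x| <= C.
  by rewrite (le_trans (WC0 x))// (le_trans (ler_norm _))// lerDl.
have WCp x : -1 <= W x / C <= 1.
  by rewrite -ler_norml normrM normfV (gtr0_norm C_gt0) ler_pdivrMr// mul1r.
(* The weights are nonnegative because [|W| <= C]; they sum to 1/2, and their difference [W / (2 C)]
   isolates [W]. *)
pose p x := 4^-1 * (1 + W x / C); pose q x := 4^-1 * (1 + - (W x / C)).
have bWC c : bounded_measurable (fun x => c * (W x / C)).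
  apply: bounded_measurableM; first exact: bounded_measurable_cst.
  by apply: bounded_measurableM => //; exact: bounded_measurable_cst.
have bp : bounded_measurable p.
  apply: bounded_measurableM; first exact: bounded_measurable_cst.
  apply: bounded_measurableD; first exact: bounded_measurable_cst.
  by have := bWC 1; under eq_fun do rewrite mul1r.
have bq : bounded_measurable q.
  apply: bounded_measurableM; first exact: bounded_measurable_cst.
  apply: bounded_measurableD; first exact: bounded_measurable_cst.
  by have := bWC (-1); under eq_fun do rewrite mulN1r.
have p0 x : 0 <= p x by rewrite /p; have /andP[] := WCp x; lra.
have q0 x : 0 <= q x by rewrite /q; have /andP[] := WCp x; lra.
have pq x : p x + q x = 1 / 2 by rewrite /p /q; field; rewrite gt_eqF.
have qp x : q x + p x = 1 / 2 by rewrite addrC pq.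
have mXt := measurable_shift_borelRV t.
have [nu1 nu1E] := exists_mixture P Q mX mXt bp bq p0 q0 pq.
have [nu2 nu2E] := exists_mixture P Q mX mXt bq bp q0 p0 qp.
have bg (g : borelRV R n -> R) (Z : T -> borelRV R n) f :
    bounded_measurable g -> measurable_fun setT Z -> bounded_measurable f ->
    bounded_measurable (fun x => f x * g (Z x)).
  move=> bg mZ bf; apply: bounded_measurableM => //.
  exact: bounded_measurable_comp bg mZ.
have diff (g : borelRV R n -> R) : bounded_measurable g ->
    \int[nu1]_y g y - \int[nu2]_y g y = (2 * C)^-1 *
      ((\int[P]_x (W x * g (X x)) - \int[P]_x (W x * g (X x + t))) -
       (\int[Q]_x (W x * g (X x)) - \int[Q]_x (W x * g (X x + t)))).
  move=> bmg; have bX := bg g X W bmg mX bW; have bXt := bg g _ W bmg mXt bW.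
  have bgm (Z : T -> borelRV R n) f : measurable_fun setT Z ->
      bounded_measurable f -> bounded_measurable (fun x => g (Z x) * f x).
    move=> mZ bf; apply: bounded_measurableM => //.
    exact: bounded_measurable_comp bmg mZ.
  rewrite nu1E// nu2E// -!bounded_RintegralB// opprD addrACA.
  rewrite -!bounded_RintegralB; try by apply: bounded_measurableD; exact: bgm.
  rewrite mulrBr -!bounded_RintegralZl; last 2 first.
  - exact: bounded_measurableB.
  - exact: bounded_measurableB.
  rewrite -[in RHS]mulN1r -bounded_RintegralZl; last first.
    apply: bounded_measurableM; first exact: bounded_measurable_cst.
    exact: bounded_measurableB.
  by congr (_ + _); apply: eq_Rintegral => x _; rewrite /p /q; field; rewrite gt_eqF.
have emb : mean_embedding H nu1 = mean_embedding H nu2.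
  apply/(mean_embedding_eq H ck bk) => c.
  apply/eqP; rewrite -subr_eq0 diff; last exact: (bounded_measurable_kernel H ck bk).
  (* By translation invariance a shift of [X] by [t] is a shift of the kernel point from [c] to
     [c - t], so [PQ] at [c] and at [c - t] cancels all four integrals. *)
  have [kappa _ kE] := tk.
  have shift (mu : probability T R) :
      \int[mu]_x (W x * k (X x + t) c) = \int[mu]_x (W x * k (X x) (c - t)).
    by apply: eq_Rintegral => x _; rewrite !kE opprB addrA.
  by rewrite !shift !PQ subrr mulr0.
move=> A mA; apply/eqP; rewrite -subr_eq0.
have bA := bounded_measurable_indic R mA.
have := diff _ bA; have /(_ _ mA) nuA := chk emb.
have intA (mu : probability (borelRV R n) R) : \int[mu]_x \1_A x = fine (mu A).
  by rewrite /Rintegral integral_indic// setIT.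
rewrite !intA nuA subrr => /esym/eqP.
by rewrite mulf_eq0 invr_eq0 mulf_eq0 pnatr_eq0/= (gt_eqF C_gt0).
Qed.

(** Shift invariance compares [A] with its translates. Cutting [A] to a slab and translating ever
    farther makes the translated term vanish pointwise, and bounded convergence leaves the integral
    over [A] alone. *)
Lemma weighted_injectivity :
  (forall a, \int[P]_x (W x * k (X x) a) = \int[Q]_x (W x * k (X x) a)) ->
  forall A : set (borelRV R n), measurable A ->
  \int[P]_x (W x * \1_A (X x)) = \int[Q]_x (W x * \1_A (X x)).
Proof.
move=> PQ A mA; pose j0 := Ordinal n0.
pose A_ m : set (borelRV R n) := A `&` [set x | `|x ord0 j0| <= m%:R].
have mA_ m : measurable (A_ m).
  apply: measurableI => //; rewrite -[X in measurable X]setTI.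
  apply: (@measurable_fun_le _ _ _ setT) => //.
  by apply: measurableT_comp => //; exact: measurable_coord.
(* The slab has width [2 m], so a shift by [2 m + 1] moves every point of it outside. *)
pose t_ (m : nat) : 'rV[R]_n := (m%:R *+ 2 + 1) *: delta_mx ord0 j0.
pose u m x := W x * (\1_(A_ m) (X x) - \1_(A_ m) (X x + t_ m)).
have [mW [C WC]] := bW.
have bXA m : bounded_measurable (fun x => W x * \1_(A_ m) (X x)).
  apply: bounded_measurableM => //.
  by apply: bounded_measurable_comp mX; exact: bounded_measurable_indic.
have bXtA m : bounded_measurable (fun x => W x * \1_(A_ m) (X x + t_ m)).
  apply: bounded_measurableM => //.
  apply: (bounded_measurable_comp (f := \1_(A_ m))).
    exact: bounded_measurable_indic.
  exact: measurable_shift_borelRV.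
have uE (mu : probability T R) m : \int[mu]_x u m x =
    \int[mu]_x (W x * \1_(A_ m) (X x)) - \int[mu]_x (W x * \1_(A_ m) (X x + t_ m)).
  rewrite -bounded_RintegralB//; apply: eq_Rintegral => x _.
  by rewrite /u mulrBr.
have lim (mu : probability T R) :
    \int[mu]_x u m x @[m --> \oo] --> \int[mu]_x (W x * \1_A (X x)).
  apply: (@bounded_convergence _ _ _ _ _ _ C).
  - move=> m; rewrite /u; under eq_fun do rewrite mulrBr.
    by apply: measurable_funB; [case: (bXA m)|case: (bXtA m)].
  - apply: measurable_funM => //; apply: measurableT_comp mX.
    exact: measurable_indic.
  - move=> m x; rewrite /u normrM -[leRHS]mulr1 ler_pM// !indicE.
    by case: (_ \in _); case: (_ \in _);
      rewrite ?subrr ?subr0 ?sub0r ?normrN ?normr0 ?normr1.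
  - move=> x; apply: cvg_near_cst.
    near=> m.
    have Xm : `|X x ord0 j0| <= m%:R.
      by near: m; exact: nbhs_infty_ger.
    rewrite /u; congr (_ * _).
    rewrite [X in _ - X](_ : _ = 0) ?subr0.
      rewrite !indicE; congr ((nat_of_bool _)%:R).
      by apply/idP/idP => /set_mem h; apply/mem_set; [case: h|split].
    rewrite indicE memNset// => -[_ /=].
    rewrite !mxE !eqxx/= mulr1 => /ler_normlW.
    by move: Xm; rewrite ler_norml => /andP[h _]; rewrite -mulr_natr; lra.
apply: (cvg_unique _ (lim P)) => //.
have := lim Q.
by under eq_fun do rewrite uE -(weighted_shift_invariance PQ)// -uE.
Unshelve. all: end_near. Qed.

End weighted_injectivity.

(** * From the product kernel to products of measurable sets *)

Section product_kernel_rectangles.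
Context {R : realType} {M : nat} {d_ : 'I_M -> nat}.
Variables (k_ : forall m, 'rV[R]_(d_ m) -> 'rV[R]_(d_ m) -> R).
Arguments k_ : clear implicits.
Variable H_ : forall m, rkhs (k_ m).
Hypotheses (d0 : forall m, (0 < d_ m)%N)
  (ck : forall m, continuous_kernel (k_ m)) (bk : forall m, bounded_kernel (k_ m))
  (tk : forall m, translation_invariant (k_ m))
  (chk : forall m, is_characteristic (H_ m)).
Local Notation D := (\sum_(m < M) d_ m)%N.

Lemma measurable_block_rect (A_ : forall m, set (borelRV R (d_ m))) :
  (forall m, measurable (A_ m)) ->
  measurable ([set x | forall m, A_ m (block m x)] : set (borelRV R D)).
Proof.
move=> mA; rewrite [X in measurable X](_ : _ =
  \bigcap_(m in [set: 'I_M]) (block m @^-1` A_ m)); last first.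
  by apply/seteqP; split=> x /= h m => [_|]; exact: h.
apply: fin_bigcap_measurable => // m _.
by rewrite -[X in measurable X]setTI; exact: measurable_block.
Qed.

Lemma prod_kernel_rect (P Q : probability (borelRV R D) R) :
  (forall a, \int[P]_x prod_kernel k_ x a = \int[Q]_x prod_kernel k_ x a) ->
  forall A_ : forall m, set (borelRV R (d_ m)), (forall m, measurable (A_ m)) ->
  fine (P [set x | forall m, A_ m (block m x)]) =
  fine (Q [set x | forall m, A_ m (block m x)]).
Proof.
move=> PQ A_ mA.
(* Hybrid product: the factors of index below [s] are already indicators, the others are still
   kernel sections at the points [a_]. *)
pose G s (a_ : forall m, 'rV[R]_(d_ m)) (m : 'I_M) (x : borelRV R D) : R :=
  if (m < s)%N then \1_(A_ m) (block m x) else k_ m (block m x) (a_ m).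
have bG s a_ m : bounded_measurable (G s a_ m).
  rewrite /G; case: (m < s)%N.
    apply: bounded_measurable_comp (@measurable_block _ _ _ m).
    exact: bounded_measurable_indic.
  apply: (@bounded_measurable_comp _ _ _ (borelRV R (d_ m)) R
    (fun x => k_ m x (a_ m)) (block m)); last exact: measurable_block.
  exact: bounded_measurable_kernel (H_ m) (@ck m) (@bk m) (a_ m).
have GPQ s a_ : \int[P]_x \prod_m G s a_ m x = \int[Q]_x \prod_m G s a_ m x.
  elim: s a_ => [|s IH] a_.
    have G0 (mu : probability (borelRV R D) R) : \int[mu]_x \prod_m G 0%N a_ m x =
        \int[mu]_x prod_kernel k_ x (\mxrow_m a_ m).
      by apply: eq_Rintegral => x _; apply: eq_bigr => m _; rewrite mxrowK.
    by rewrite !G0.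
  (* For [s >= M] every factor is already an indicator and the product does not change. *)
  have [sM|Ms] := ltnP s M; last first.
    have GE (m : 'I_M) x : G s.+1 a_ m x = G s a_ m x.
      by rewrite /G ltnS !(leq_trans _ Ms)// ltnW.
    have GsE (mu : probability (borelRV R D) R) :
        \int[mu]_x \prod_m G s.+1 a_ m x = \int[mu]_x \prod_m G s a_ m x.
      by apply: eq_Rintegral => x _; apply: eq_bigr => m _; exact: GE.
    by rewrite !GsE.
  pose m0 := Ordinal sM.
  (* [W] collects all factors except the one being replaced; it is bounded but may change sign,
     which is why weighted injectivity is stated for signed weights. *)
  pose W x := \prod_(m | m != m0) G s.+1 a_ m x.
  have bW : bounded_measurable W by exact: bounded_measurable_prod.
  have split_prod (mu : probability (borelRV R D) R) :
      \int[mu]_x \prod_m G s.+1 a_ m x =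
      \int[mu]_x (W x * \1_(A_ m0) (block m0 x)).
    apply: eq_Rintegral => x _; rewrite (bigD1 m0)//= mulrC; congr (_ * _).
    by rewrite /G ltnS leqnn.
  rewrite !split_prod.
  apply: (weighted_injectivity (d0 m0) (@ck m0) (bk m0) (tk m0) (@chk m0)
    (@measurable_block _ _ _ m0) bW _ (mA m0)) => a.
  (* The point [a] is put in slot [m0] of [a_]; the induction hypothesis holds for every choice of
     points, so it gives the equality for every section of [k_ m0]. *)
  have IHa (mu : probability (borelRV R D) R) :
      \int[mu]_x (W x * k_ m0 (block m0 x) a) =
      \int[mu]_x \prod_m G s (dfwith a_ m0 a) m x.
    apply: eq_Rintegral => x _; rewrite [RHS](bigD1 m0)//= mulrC; congr (_ * _).
      by rewrite /G ltnn dfwithin.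
    apply: eq_bigr => m mm0; rewrite /G ltnS leq_eqVlt.
    rewrite (negbTE (_ : (m : nat) != s)) ?dfwithout// eq_sym//.
  by rewrite !IHa IH.
have a0 : forall m, 'rV[R]_(d_ m) by move=> m; exact: 0.
have := GPQ M a0.
have GE (mu : probability (borelRV R D) R) : \int[mu]_x \prod_m G M a0 m x =
    fine (mu [set x | forall m, A_ m (block m x)]).
  rewrite -[X in mu X]setIT -integral_indic//; last exact: measurable_block_rect.
  apply: eq_Rintegral => x _; rewrite indicE.
  have [/set_mem h|/negP h] := boolP (x \in _).
    by rewrite big1// => m _; rewrite /G ltn_ord indicE mem_set.
  have /existsNP[m hm] : ~ forall m, A_ m (block m x).
    by move=> h'; apply: h; exact/mem_set.
  by rewrite (bigD1 m)//= /G ltn_ord indicE memNset// mul0r.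
by rewrite !GE.
Qed.

End product_kernel_rectangles.

(** * Sheared Gaussian laws *)

Section shear.
Context {R : realType} {n : nat}.
Variables (i j : 'I_n).
Hypothesis ij : i != j.
Local Notation N01 := (@normal_prob R 0 1).
Local Notation G := (power_prob N01 n).
Implicit Types (r e : R) (z : n.-tuple (measurableTypeR R)).

(** Row vectors are multiplied on the right, so the entry at [(i, j)] adds [r] times coordinate [i]
    to coordinate [j]. *)
Definition shear_mx r : 'M[R]_n := 1%:M + r *: delta_mx i j.

Definition shear_law r : probability (borelRV R n) R := gaussian 0 (shear_mx r).

(** For [i != j] the matrix unit squares to zero, so the inverse is the shear by [- r]. The laws on
    the path are therefore nondegenerate Gaussians. *)
Lemma shear_mx_unit r : shear_mx r \in unitmx.
Proof.
suff : shear_mx r *m shear_mx (- r) = 1%:M by case/mulmx1_unit.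
rewrite /shear_mx mulmxDl mul1mx mulmxDr mulmx1 -scalemxAl -scalemxAr.
by rewrite mul_delta_mx_0 1?eq_sym// !scaler0 addr0 scaleNr addrNK.
Qed.

Lemma shear_mapE r z l :
  affine_map 0 (shear_mx r) z ord0 l =
  tnth z l + (if l == j then r * tnth z i else 0).
Proof.
rewrite /affine_map add0r mulmxDr mulmx1 -scalemxAr !mxE; congr (_ + _).
rewrite (bigD1 i)//= big1 => [|m mi]; rewrite !mxE; last first.
  by rewrite (negbTE mi)/= mulr0.
by rewrite eqxx/= addr0; case: (l == j); rewrite /= ?mulr1 ?mulr0.
Qed.

(** Turns a change of parameter into a translation of [z_j] by [e z_i], an amount that does not
    depend on [z_j] itself. *)
Lemma shear_mapD r e z :
  affine_map 0 (shear_mx (r + e)) z =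
  affine_map 0 (shear_mx r) (tuple_upd j z (tnth z j + e * tnth z i)).
Proof.
apply/matrixP => o l; rewrite (ord1 o) !shear_mapE !tnth_upd (negbTE ij).
by case: eqP => [->|_]//; ring.
Qed.

Lemma measurable_shear_map r : measurable_fun setT (affine_map 0 (shear_mx r)).
Proof. exact: measurable_affine_map. Qed.

Lemma ge0_integral_shear_law r (g : borelRV R n -> \bar R) :
  measurable_fun setT g -> (forall x, 0 <= g x)%E ->
  (\int[shear_law r]_x g x = \int[G]_z g (affine_map 0 (shear_mx r) z))%E.
Proof. by move=> mg g0; rewrite ge0_integral_distribution. Qed.

(** At [(v, x)] this is the density of [N(v, 1)] with respect to [N(0, 1)]. *)
Definition shift_weight (p : R * R) : R := expR (p.1 * p.2 - p.1 ^+ 2 / 2).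

Lemma measurable_shift_weight : measurable_fun setT shift_weight.
Proof.
apply: measurableT_comp => //; apply: measurable_funB.
  exact: measurable_funM.
by apply: measurable_funM => //; exact: measurable_funX.
Qed.

Lemma gaussian_shift (h : n.-tuple (measurableTypeR R) -> R) (l : 'I_n)
    (g : n.-tuple (measurableTypeR R) -> \bar R) :
  measurable_fun setT h -> (forall z x, h (tuple_upd l z x) = h z) ->
  measurable_fun setT g -> (forall z, 0 <= g z)%E ->
  (\int[G]_z g (tuple_upd l z (tnth z l + h z)%R) =
   \int[G]_z (g z * (shift_weight (h z, tnth z l))%:E))%E.
Proof.
apply: (@ge0_integral_power_prob_upd _ _ _ N01 _ (measurableTypeR R)
  (fun p => p.2 + p.1) shift_weight).
- exact: measurable_funD.
- exact: measurable_shift_weight.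
- by move=> p; exact: expR_ge0.
- by move=> v g' mg' g'0; exact: integral_normal01_shift.
Qed.

Lemma gaussian_opp (l : 'I_n) (g : n.-tuple (measurableTypeR R) -> \bar R) :
  measurable_fun setT g -> (forall z, 0 <= g z)%E ->
  (\int[G]_z g (tuple_upd l z (- tnth z l)%R) = \int[G]_z g z)%E.
Proof.
move=> mg g0.
have := @ge0_integral_power_prob_upd _ _ _ N01 _ (measurableTypeR R)
  (fun p => - p.2) (fun=> 1) _ _ _ _ n l (fun=> 0) g.
move=> /(_ _ _ _ _)/wrap[]//.
- exact: measurableT_comp.
- move=> v g' mg' g'0; under [RHS]eq_integral do rewrite mule1.
  exact: integral_normal01_opp.
by move=> ->//; apply: eq_integral => z _; rewrite mule1.
Qed.

(** Density of the law at [r + e] relative to the law at [r]: undoing the shear gives [z_i = x_i]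
    and [z_j = x_j - r x_i], and the shift of [z_j] is [e x_i]. *)
Definition shear_density r e (x : borelRV R n) : R :=
  expR (e * x ord0 i * (x ord0 j - r * x ord0 i) - (e * x ord0 i) ^+ 2 / 2).

Lemma measurable_shear_density r e : measurable_fun setT (shear_density r e).
Proof.
apply: measurableT_comp => //.
have mi := @measurable_coord R _ i; have mj := @measurable_coord R _ j.
apply: measurable_funB; apply: measurable_funM => //.
- exact: measurable_funM.
- by apply: measurable_funB => //; exact: measurable_funM.
- by apply: measurable_funX; exact: measurable_funM.
Qed.

Lemma shear_density_map r e z :
  shear_density r e (affine_map 0 (shear_mx r) z) =
  shift_weight (e * tnth z i, tnth z j).
Proof.
rewrite /shear_density /shift_weight !shear_mapE (negbTE ij) eqxx addr0/=.
by congr expR; ring.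
Qed.

Lemma measurable_scaled_coord e l : measurable_fun setT (fun z => e * tnth z l).
Proof. by apply: measurable_funM => //; exact: measurable_tnth. Qed.

Lemma shear_law_density r e (g : borelRV R n -> \bar R) :
  measurable_fun setT g -> (forall x, 0 <= g x)%E ->
  (\int[shear_law (r + e)]_x g x =
   \int[shear_law r]_x (g x * (shear_density r e x)%:E))%E.
Proof.
move=> mg g0; rewrite !ge0_integral_shear_law//; last 2 first.
- apply: emeasurable_funM => //; apply/measurable_EFinP.
  exact: measurable_shear_density.
- by move=> x; rewrite mule_ge0// lee_fin expR_ge0.
under eq_integral do rewrite shear_mapD.
have mh := measurable_scaled_coord e i.
have hj z x : e * tnth (tuple_upd j z x) i = e * tnth z i.
  by rewrite tnth_upd (negbTE ij).
have mgT := measurableT_comp mg (measurable_shear_map r).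
apply: etrans (gaussian_shift mh hj mgT (fun z => g0 _)) _.
by apply: eq_integral => z _; rewrite /= shear_density_map.
Qed.

End shear.

Lemma sqrtr_expR (R : realType) (x : R) : Num.sqrt (expR x) = expR (x / 2).
Proof.
by rewrite [in LHS](splitr x) expRD -expr2 sqrtr_sqr ger0_norm ?expR_ge0.
Qed.

(** For [x >= 0], [expR x] is the square of [expR (x / 2) >= 1 + x / 2]. This bounds the Gaussian
    second moment by exponential moments. *)
Lemma sqr_le_expR (R : realType) (x : R) : x ^+ 2 <= 4 * (expR x + expR (- x)).
Proof.
wlog x0 : x / 0 <= x => [hw|].
  have [|/ltW x0] := leP 0 x; first exact: hw.
  by have := hw (- x); rewrite sqrrN opprK [expR (- x) + _]addrC oppr_ge0; exact.
have h1 := expR_ge1Dx (x / 2); have h2 := expR_ge0 (- x).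
rewrite [in expR x](splitr x) expRD; nra.
Qed.

(** * Hellinger affinity along the shear path *)

Section shear_affinity.
Context {R : realType} {n : nat}.
Variables (i j : 'I_n).
Hypothesis ij : i != j.
Local Notation N01 := (@normal_prob R 0 1).
Local Notation G := (power_prob N01 n).

(** The shift formula for the constant function 1 says that the shift weight has integral 1. *)
Lemma gaussian_expR (l : 'I_n) (v : R) :
  (\int[G]_z (expR (v * tnth z l))%:E = (expR (v ^+ 2 / 2))%:E)%E.
Proof.
have mw : measurable_fun [set: n.-tuple (measurableTypeR R)]
    (fun z => (shift_weight (v, tnth z l))%:E).
  apply/measurable_EFinP; apply: (measurableT_comp (f := @shift_weight R)).
    exact: measurable_shift_weight.
  exact: (measurableT_comp (pair1_measurable v) (measurable_tnth l)).
have := @gaussian_shift R n (fun=> v) l (fun=> 1%E) _ _ _ _.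
move=> /(_ _ _ _ _)/wrap[]//.
under [X in _ = X -> _]eq_integral do rewrite mul1e.
rewrite integral_cst//= probability_setT mule1 => int1.
rewrite -[RHS]mule1 int1 -ge0_integralZl//=; last first.
  by move=> z _; rewrite lee_fin expR_ge0.
apply: eq_integral => z _; rewrite -EFinM /shift_weight/= -expRD.
by congr (expR _)%:E; ring.
Qed.

(** The root of the density is the weight of half the shift times [expR (- (e z_i) ^+ 2 / 8)].
    Integrating out [z_j] leaves the mean of the latter factor, hence a bound uniform in [r]. *)
Lemma shear_affinity (r e : R) :
  ((1 - e ^+ 2 * expR (1 / 2))%:E <=
   \int[shear_law i j r]_x (Num.sqrt (shear_density i j r e x))%:E)%E.
Proof.
pose g (z : n.-tuple (measurableTypeR R)) := (expR (- (e * tnth z i) ^+ 2 / 8))%:E.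
have mtn c l : measurable_fun [set: n.-tuple (measurableTypeR R)]
    (fun z => c * tnth z l).
  by apply: measurable_funM => //; exact: measurable_tnth.
have mg : measurable_fun setT g.
  apply/measurable_EFinP; apply: measurableT_comp => //.
  apply: measurable_funM => //; apply: measurableT_comp => //.
  by apply: measurable_funX; exact: mtn.
have g0 z : (0 <= g z)%E by rewrite lee_fin expR_ge0.
have -> : (\int[shear_law i j r]_x (Num.sqrt (shear_density i j r e x))%:E =
    \int[G]_z g z)%E.
  rewrite ge0_integral_shear_law; last 2 first.
  - apply/measurable_EFinP; apply: (measurableT_comp (f := @Num.sqrt R)).
      exact: measurable_sqrt.
    exact: measurable_shear_density.
  - by move=> x; rewrite lee_fin sqrtr_ge0.
  have hj z x : e / 2 * tnth (tuple_upd j z x) i = e / 2 * tnth z i :> R.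
    by rewrite tnth_upd (negbTE ij).
  transitivity (\int[G]_z (g z * (shift_weight ((e / 2 * tnth z i)%R, tnth z j))%:E))%E.
    apply: eq_integral => z _; rewrite shear_density_map// sqrtr_expR -EFinM -expRD.
    by congr (expR _)%:E; rewrite /=; field.
  (* The half-shift weight is absorbed by translating [z_j], a coordinate that [g] does not see. *)
  apply: etrans (esym (gaussian_shift (mtn (e / 2) i) hj mg g0)) _.
  by apply: eq_integral => z _; rewrite /g tnth_upd (negbTE ij).
have mE c : measurable_fun [set: n.-tuple (measurableTypeR R)]
    (fun z => (expR (c * tnth z i))%:E).
  by apply/measurable_EFinP; apply: measurableT_comp => //; exact: mtn.
have E0 c (z : n.-tuple (measurableTypeR R)) : (0 <= (expR (c * tnth z i))%:E)%E.
  by rewrite lee_fin expR_ge0.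
have c0 : (0 <= (e ^+ 2 / 2)%:E)%E by rewrite lee_fin divr_ge0// sqr_ge0.
(* Written as a sum so that all extended integrals stay nonnegative; [expR (1 / 2)] comes from the
   exponential moments at 1 and -1. *)
have key : (1%:E <= \int[G]_z g z + (e ^+ 2 * expR (1 / 2))%:E)%E.
  have -> : ((e ^+ 2 * expR (1 / 2))%:E = (e ^+ 2 / 2)%:E *
      (\int[G]_z ((expR (1 * tnth z i))%:E + (expR (-1 * tnth z i))%:E)))%E.
    rewrite ge0_integralD// !gaussian_expR sqrrN expr1n -EFinD -EFinM.
    by congr _%:E; field.
  rewrite -ge0_integralZl//; last 2 first.
  - exact: emeasurable_funD.
  - by move=> z _; rewrite adde_ge0.
  rewrite -ge0_integralD//; last 2 first.
  - by move=> z _; rewrite mule_ge0// adde_ge0.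
  - by apply: emeasurable_funM => //; exact: emeasurable_funD.
  apply: (@le_trans _ _ (\int[G]_z 1%:E)%E).
    by rewrite integral_cst//= probability_setT mule1.
  apply: ge0_le_integral => //.
  - apply: emeasurable_funD => //; apply: emeasurable_funM => //.
    exact: emeasurable_funD.
  - move=> z _; rewrite /g -EFinD lee_fin mul1r mulN1r.
    have := expR_ge1Dx (- (e * tnth z i) ^+ 2 / 8).
    have := sqr_le_expR (tnth z i); have := sqr_ge0 e.
    by rewrite exprMn; nra.
by rewrite EFinB leeBlDr.
Qed.

End shear_affinity.

(** * Shears across two blocks: marginals and a quadrant *)

Section block_shear.
Context {R : realType} {M : nat} {d_ : 'I_M -> nat}.
Local Notation D := (\sum_(m < M) d_ m)%N.
Variables (m1 m2 : 'I_M) (q1 : 'I_(d_ m1)) (q2 : 'I_(d_ m2)).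
Hypothesis m12 : m1 != m2.
Local Notation i := (tagnat.Rank m1 q1).
Local Notation j := (tagnat.Rank m2 q2).
Local Notation N01 := (@normal_prob R 0 1).
Local Notation G := (power_prob N01 D).
Local Notation law r := (shear_law i j r : probability (borelRV R D) R).
Local Notation shear r := (affine_map 0 (shear_mx i j r)).

Implicit Types (r : R) (z : D.-tuple (measurableTypeR R)).

Lemma Rank_neq m m' (q : 'I_(d_ m)) (q' : 'I_(d_ m')) :
  m != m' -> (tagnat.Rank m q == tagnat.Rank m' q') = false.
Proof.
move=> mm'; apply/negP => /eqP/(congr1 (@tagnat.sig1 _ _)).
by rewrite !tagnat.Rank1K => mE; rewrite mE eqxx in mm'.
Qed.

Lemma blockE m (x : borelRV R D) q : block m x ord0 q = x ord0 (tagnat.Rank m q).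
Proof. by rewrite /block mxE. Qed.

Let ij : i != j. Proof. by rewrite Rank_neq. Qed.

Lemma block_shear_neq m r r' z : m != m2 ->
  block m (shear r z) = block m (shear r' z).
Proof.
move=> mm2; apply/matrixP => o q; rewrite (ord1 o) !blockE.
by rewrite !shear_mapE Rank_neq.
Qed.

Lemma block_shear_opp r z :
  block m2 (shear (- r) (tuple_upd i z (- tnth z i))) = block m2 (shear r z).
Proof.
apply/matrixP => o q; rewrite (ord1 o) !blockE.
rewrite !shear_mapE !tnth_upd eqxx mulrNN.
by rewrite (Rank_neq q q1) 1?eq_sym.
Qed.

Lemma marginal_shearE m r (A : set (borelRV R (d_ m))) : measurable A ->
  marginal (law r) m A = (\int[G]_z (\1_A (block m (shear r z)))%:E)%E.
Proof.
move=> mA; have mB : measurable (block m @^-1` A : set (borelRV R D)).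
  by rewrite -[X in measurable X]setTI; exact: measurable_block.
transitivity (\int[law r]_x (\1_(block m @^-1` A) x)%:E)%E.
  by rewrite integral_indic// setIT.
rewrite ge0_integral_shear_law//.
exact/measurable_EFinP/measurable_indic.
Qed.

(** Only block [m2] depends on [r], and it contains coordinate [j] but not [i]. Flipping the sign of
    [z_i] preserves the Gaussian law and turns [r] into [- r] there. *)
Lemma marginal_shear_opp m r (A : set (borelRV R (d_ m))) : measurable A ->
  marginal (law r) m A = marginal (law (- r)) m A.
Proof.
move=> mA; rewrite (marginal_shearE r mA) (marginal_shearE (- r) mA).
have [mm2|mm2] := eqVneq m m2; last first.
  by apply: eq_integral => z _; rewrite (block_shear_neq r (- r)).
subst m.
rewrite -[RHS](gaussian_opp i) => [| |z]; last 2 first.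
- apply/measurable_EFinP; apply: measurableT_comp; first exact: measurable_indic.
  apply: measurableT_comp; first exact: measurable_block.
  exact: measurable_shear_map.
- by rewrite lee_fin.
by apply: eq_integral => z _; rewrite block_shear_opp.
Qed.

(** In terms of [z] the quadrant is [E r]. The event at -1 lies inside the event at 1, and the
    difference contains a box of positive mass. *)
Lemma shear_law_quadrant (A_ : forall m, set (borelRV R (d_ m))) :
  (forall m, measurable (A_ m)) ->
  (forall x, (forall m, A_ m (block m x)) <-> 0 < x ord0 i /\ 0 < x ord0 j) ->
  (law (-1) [set x | forall m, A_ m (block m x)] <
   law 1 [set x | forall m, A_ m (block m x)])%E.
Proof.
move=> mA AE.
pose E r := [set z | 0 < tnth z i /\ 0 < tnth z j + r * tnth z i] :
  set (D.-tuple (measurableTypeR R)).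
have lawE r : law r [set x | forall m, A_ m (block m x)] = G (E r).
  rewrite /shear_law /gaussian /distribution /pushforward; congr (G _).
  apply/seteqP; split=> z /=.
    by move/AE; rewrite !shear_mapE (negbTE ij) eqxx addr0.
  by move=> Ez; apply/AE; rewrite !shear_mapE (negbTE ij) eqxx addr0.
(* With [1 < z_i < 2] and [-1 < z_j < 1], the sum [z_j + z_i] is positive while [z_j - z_i] is
   negative. *)
pose B l : set (measurableTypeR R) := if l == i then `]1, 2[%classic else
  if l == j then `](-1), 1[%classic else setT.
have mB l : measurable (B l).
  by rewrite /B; case: (l == i); last case: (l == j) => //; exact: measurable_itv.
pose F : set (D.-tuple (measurableTypeR R)) := [set z | forall l, B l (tnth z l)].
have mtn l : measurable_fun setT (fun z : D.-tuple (measurableTypeR R) => tnth z l).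
  exact: measurable_tnth.
have mF : measurable F.
  rewrite [X in measurable X](_ : _ = \bigcap_(l in [set: 'I_D])
      ((fun z : D.-tuple (measurableTypeR R) => tnth z l) @^-1` B l)); last first.
    by apply/seteqP; split=> z /= h l => [_|]; exact: h.
  by apply: fin_bigcap_measurable => // l _; rewrite -[X in measurable X]setTI; exact: mtn.
have mE r : measurable (E r).
  have -> : E r = [set z | 0 < tnth z i] `&` [set z | 0 < tnth z j + r * tnth z i] by [].
  have mr : measurable_fun setT (fun z : D.-tuple (measurableTypeR R) =>
      tnth z j + r * tnth z i).
    by apply: measurable_funD; [exact: mtn|exact: measurable_scaled_coord].
  have pos (g : D.-tuple (measurableTypeR R) -> R) : measurable_fun setT g ->
      measurable [set z | 0 < g z].
    move=> mg; rewrite -[X in measurable X]setTI.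
    rewrite [X in _ `&` X](_ : _ = g @^-1` `]0, +oo[%classic).
      by apply: mg => //; exact: measurable_itv.
    by apply/seteqP; split=> z /=; rewrite in_itv/= andbT.
  exact: (measurableI _ _ (pos _ (mtn i)) (pos _ mr)).
rewrite !lawE.
have GF : (0 < G F)%E.
  rewrite power_probE//; apply: (big_ind (fun x => 0 < x)%E) => [|x y x0 y0|l _].
  - exact: lte01.
  - by rewrite mule_gt0.
  - rewrite /B; case: (l == i); first by apply: normal01_itv_gt0; lra.
    case: (l == j); first by apply: normal01_itv_gt0; lra.
    by rewrite [ltRHS]probability_setT.
have EF : E (-1) `|` F `<=` E 1.
  move=> z [[zi zj]|Fz]; first by split=> //; lra.
  have := Fz i; have := Fz j; rewrite /B eqxx eq_sym (negbTE ij) eqxx/= !in_itv/=.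
  by move=> /andP[h1 h2] /andP[h3 h4]; split; lra.
have disj : E (-1) `&` F = set0.
  rewrite -subset0 => z [[zi zj] Fz].
  have := Fz i; have := Fz j; rewrite /B eqxx eq_sym (negbTE ij) eqxx/= !in_itv/=.
  move=> /andP[h1 h2] /andP[h3 h4].
  have lt10 : (1 : R) < 0 by lra.
  by rewrite ltr10 in lt10.
apply: (@lt_le_trans _ _ (G (E (-1)%R) + G F)%E).
  by rewrite lteDl// fin_num_measure.
rewrite -measureU//.
by apply: le_measure => //; rewrite inE//; exact: measurableU.
Qed.

End block_shear.

(** * Separation of the cross-covariance operators *)

Lemma continuous_prod (T : topologicalType) (R : realType) (I : Type) (s : seq I)
    (f : I -> T -> R) : (forall i, continuous (f i)) ->
  continuous (fun x => \prod_(i <- s) f i x).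
Proof.
move=> cf; elim: s => [|i s IH] x.
  under eq_fun do rewrite big_nil.
  exact: cvg_cst.
under eq_fun do rewrite big_cons.
exact: (continuousM (@cf i x) (IH x)).
Qed.

Section product_kernel_facts.
Context {R : realType} {M : nat} {d_ : 'I_M -> nat}.
Variables (k_ : forall m, 'rV[R]_(d_ m) -> 'rV[R]_(d_ m) -> R).
Arguments k_ : clear implicits.
Hypotheses (ck : forall m, continuous_kernel (k_ m))
  (bk : forall m, bounded_kernel (k_ m)).
Local Notation D := (\sum_(m < M) d_ m)%N.

Lemma continuous_submxrow m : continuous (fun x : 'rV[R]_D => submxrow x m).
Proof.
move=> x B /nbhs_ballP[e /= e0 xeB].
apply/nbhs_ballP; exists e => //= y /(mx_ballE _ _ e0) xy.
by apply: xeB; apply/mx_ballE => // q; rewrite !mxE.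
Qed.

Lemma continuous_prod_kernel : continuous_kernel (prod_kernel k_).
Proof.
apply: continuous_prod => m p.
have c1 : submxrow q.1 m @[q --> p] --> submxrow p.1 m.
  apply: (@continuous_comp _ _ _ fst (fun x : 'rV[R]_D => submxrow x m)).
    exact: cvg_fst.
  exact: continuous_submxrow.
have c2 : submxrow q.2 m @[q --> p] --> submxrow p.2 m.
  apply: (@continuous_comp _ _ _ snd (fun x : 'rV[R]_D => submxrow x m)).
    exact: cvg_snd.
  exact: continuous_submxrow.
exact: (@continuous2_cvg _ _ _ _ (nbhs p) (nbhs_filter p) _ _ (k_ m) _ _
  (@ck m (submxrow p.1 m, submxrow p.2 m)) c1 c2).
Qed.

Lemma bounded_prod_kernel : bounded_kernel (prod_kernel k_).
Proof.
have /choice[B BP] : forall m, exists B, forall x y, `|k_ m x y| <= B by [].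
exists (\prod_m B m) => x y; rewrite normr_prod.
by apply: ler_prod => m _; rewrite normr_ge0 BP.
Qed.

End product_kernel_facts.

(** Equal marginals give equal embeddings of the products of marginals, so equal cross-covariances
    would force equal embeddings of [P] and [Q], hence agreement on all products of blocks. *)
Lemma cross_cov_separation (R : realType) (M : nat) (d_ : 'I_M -> nat)
    (k_ : forall m, 'rV[R]_(d_ m) -> 'rV[R]_(d_ m) -> R)
    (H_ : forall m, rkhs (k_ m)) (H : rkhs (prod_kernel k_))
    (P Q : probability (borelRV R (\sum_(m < M) d_ m)%N) R)
    (A_ : forall m, set (borelRV R (d_ m))) :
  (forall m, (0 < d_ m)%N) ->
  (forall m, continuous_kernel (k_ m)) -> (forall m, bounded_kernel (k_ m)) ->
  (forall m, translation_invariant (k_ m)) ->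
  (forall m, is_characteristic (H_ m)) ->
  (forall m A, measurable A -> marginal P m A = marginal Q m A) ->
  (forall m, measurable (A_ m)) ->
  (P [set x | forall m, A_ m (block m x)] != Q [set x | forall m, A_ m (block m x)]) ->
  cross_cov H P != cross_cov H Q.
Proof.
move=> d0 ck bk tk chk PQ mA; apply: contra_neq.
have cpk := continuous_prod_kernel ck; have bpk := bounded_prod_kernel bk.
(* The product of the marginals is built from independent draws, so the integral of the product
   kernel factors over the blocks. *)
have prodE (mu : probability (borelRV R (\sum_(m < M) d_ m)%N) R) a :
    \int[prod_marginals mu]_x prod_kernel k_ x a =
    \prod_m \int[marginal mu m]_y k_ m y (submxrow a m).
  have bkm m : bounded_measurable
      (fun y : borelRV R (d_ m) => k_ m y (submxrow a m)).
    exact: (bounded_measurable_kernel (H_ m) (@ck m) (@bk m)).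
  rewrite /prod_marginals bounded_Rintegral_distribution; last first.
    exact: (bounded_measurable_kernel H cpk bpk).
  transitivity (\int[power_prob mu M]_t
      \prod_m k_ m (block m (tnth t m)) (submxrow a m)).
    apply: eq_Rintegral => t _; apply: eq_bigr => m _.
    by rewrite /join_blocks mxrowK.
  rewrite (Rintegral_power_prob_prod mu
    (f := fun m x => k_ m (block m x) (submxrow a m))) => [|m]; last first.
    exact: (bounded_measurable_comp (bkm m) (@measurable_block _ _ _ m)).
  by apply: eq_bigr => m _; rewrite /marginal bounded_Rintegral_distribution.
rewrite /cross_cov.
have -> : mean_embedding H (prod_marginals P) = mean_embedding H (prod_marginals Q).
  apply/(mean_embedding_eq H cpk bpk) => a; rewrite !prodE.
  apply: eq_bigr => m _; congr fine.
  by apply: eq_measure_integral => A mA' _; exact: PQ.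
move=> /addIr/(mean_embedding_eq H cpk bpk) int_eq.
have rect := prod_kernel_rect d0 ck bk tk chk int_eq mA.
have mR := measurable_block_rect mA.
by rewrite -[LHS]fineK ?fin_num_measure// rect fineK// fin_num_measure.
Qed.

(** * The minimax lower bound *)

(** If all [N] increments were smaller than the average, telescoping and the triangle inequality
    would make the total smaller than itself. *)
Lemma exists_large_increment (R : realType) (V : normedModType R) (u : nat -> V) N :
  (0 < N)%N -> exists2 s, (s < N)%N & `|u N - u 0%N| / N%:R <= `|u s.+1 - u s|.
Proof.
move=> N0; apply: contrapT => /forall2NP small.
have N0R : 0 < N%:R :> R by rewrite ltr0n.
have : `|u N - u 0%N| < `|u N - u 0%N|.
  rewrite -{1}(telescope_sumr u (leq0n N)) big_mkord.
  apply: le_lt_trans (ler_norm_sum _ _ _) _.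
  rewrite -[ltRHS](divfK (lt0r_neq0 N0R)) mulr_natr -[X in _ *+ X]card_ord.
  rewrite -sumr_const; apply: ltr_sum => [|s _].
    by apply/hasP; exists (Ordinal N0); rewrite ?mem_index_enum.
  by case: (small s) => // /negP; rewrite -ltNge.
by rewrite ltxx.
Qed.

(** Since [4 / 9 <= 5 / 8], the root is at least 2/3. The two-point argument can thus aim at the
    rational level 1/6. *)
Lemma minimax_constant_le_sixth (R : realType) :
  (1 - Num.sqrt (5%:R / 8%:R)) / 2%:R <= 6^-1 :> R.
Proof.
have : (2 / 3 : R) <= Num.sqrt (5%:R / 8%:R).
  rewrite -(@ger0_norm R (2 / 3)) ?divr_ge0// -sqrtr_sqr ler_wsqrtr//.
  by rewrite expr2; lra.
by lra.
Qed.

Lemma measurable_deviation d (T : measurableType d) (R : realType)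
    (V : normedModType R) (F : T -> V) (a : V) (s : R) :
  borel_measurable F -> measurable [set x | s <= `|a - F x|].
Proof.
move=> mF; rewrite [X in measurable X](_ : _ = ~` (F @^-1` [set v | `|a - v| < s])).
  apply: measurableC; apply: mF.
  rewrite [X in open X](_ : _ = (fun v => `|a - v|) @^-1` `]-oo, s[%classic).
    apply: open_comp; last exact: interval_open.
    move=> v _; apply: cvg_norm; apply: cvgB; [exact: cvg_cst|exact: cvg_id].
  by apply/seteqP; split=> v /=; rewrite in_itv.
by apply/seteqP; split=> x /=; [rewrite leNgt => /negP|move=> /negP; rewrite -leNgt].
Qed.

(* An estimate [s]-close to [a] is [s]-far from [b], so thresholding [`|a - F t|]
   is a test between [P] and [Q]. *)
Lemma two_point_testing d (T : measurableType d) (R : realType)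
    (V : normedModType R) (P Q : probability T R) (L : T -> R) n
    (F : n.-tuple T -> V) (a b : V) (s e : R) :
  measurable_fun setT L -> (forall x, 0 <= L x) ->
  (forall g : T -> \bar R, measurable_fun setT g -> (forall x, 0 <= g x)%E ->
     (\int[Q]_x g x = \int[P]_x (g x * (L x)%:E))%E) ->
  0 <= e <= 1 -> ((1 - e)%:E <= \int[P]_x (Num.sqrt (L x))%:E)%E ->
  n%:R * e <= 4^-1 -> borel_measurable F -> 2 * s <= `|b - a| ->
  3^-1 <= fine (power_prob Q n [set t | s <= `|b - F t|]) +
          fine (power_prob P n [set t | s <= `|a - F t|]).
Proof.
move=> mL L0 QL e01 aff ne mF sab.
have mB c := measurable_deviation c s mF.
have := hellinger_testing_power mL L0 QL e01 aff (measurableC (mB a)).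
rewrite setCK.
have : fine (power_prob Q n (~` [set t | s <= `|a - F t|])) <=
       fine (power_prob Q n [set t | s <= `|b - F t|]).
  apply: fine_le; rewrite ?fin_num_measure//; first exact: measurableC.
  apply: le_measure; rewrite ?inE//; first exact: measurableC.
  move=> t /= /negP; rewrite -ltNge => aF.
  have := ler_distD (F t) b a; rewrite [`|F t - a|]distrC; lra.
(* From [1 - 1/4 <= 1/2 + 3/4 S], where [S] is the sum of the two errors, follows [S >= 1/3]. *)
lra.
Qed.

Lemma sixth_le_of_sum (R : realFieldType) (x y : R) :
  3^-1 <= x + y -> y < 6^-1 -> 6^-1 <= x.
Proof. by lra. Qed.

Theorem corollary1 (R : realType) (M : nat) (d_ : 'I_M -> nat)
    (P_ : set (probability (borelRV R (\sum_(m < M) d_ m)%N) R))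
    (k_ : forall m, 'rV[R]_(d_ m) -> 'rV[R]_(d_ m) -> R)
    (H_ : forall m, rkhs (k_ m)) (H : rkhs (prod_kernel k_)) :
  (2 <= M)%N ->
  (forall m, (0 < d_ m)%N) ->
  (forall mu A, A \in unitmx -> P_ (gaussian mu A)) ->
  (forall m, [/\ is_kernel (k_ m), jointly_measurable (k_ m),
                 bounded_kernel (k_ m) & continuous_kernel (k_ m)]) ->
  (forall m, translation_invariant (k_ m)) ->
  (forall m, is_characteristic (H_ m)) ->
  exists2 c : R, 0 < c & forall n : nat, (2 <= n)%N ->
    (((1 - Num.sqrt (5%:R / 8%:R)) / 2%:R)%:E <=
     ereal_inf [set ereal_sup
       [set power_prob P n
          [set s | (c / Num.sqrt n%:R <= `|cross_cov H P - F s|)%R]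
       | P in P_]
     | F in [set F : n.-tuple (borelRV R (\sum_(m < M) d_ m)%N) -> H |
               borel_measurable F]])%E.
Proof.
move=> M2 d0 hP hk tk chk.
have ck m : continuous_kernel (k_ m) by case: (hk m).
have bk m : bounded_kernel (k_ m) by case: (hk m).
(* [M2] unfolds to [1 < M], so these are blocks 0 and 1; the shear acts between their first
   coordinates. *)
pose m1 : 'I_M := Ordinal (ltnW M2); pose m2 : 'I_M := Ordinal M2.
have m12 : m1 != m2 by [].
pose i := tagnat.Rank m1 (Ordinal (d0 m1)).
pose j := tagnat.Rank m2 (Ordinal (d0 m2)).
have ij : i != j by rewrite Rank_neq.
pose law r : probability (borelRV R (\sum_(m < M) d_ m)%N) R := shear_law i j r.
pose C r : H := cross_cov H (law r).
have Pl r : P_ (law r) by apply: hP; exact: shear_mx_unit.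
have sep : C (-1) != C 1.
  (* A half-space in blocks [m1] and [m2] and the whole space elsewhere, so that the product is the
     quadrant. *)
  pose A_ m : set (borelRV R (d_ m)) :=
    [set y | m \in [:: m1; m2] -> 0 < y ord0 (Ordinal (d0 m))].
  have mA m : measurable (A_ m).
    rewrite /A_; case: (m \in _); last first.
      by rewrite [X in measurable X](_ : _ = setT)//; apply/seteqP; split.
    rewrite [X in measurable X](_ : _ = setT `&`
        (fun y : borelRV R (d_ m) => y ord0 (Ordinal (d0 m))) @^-1` `]0, +oo[%classic).
      by apply: measurable_coord => //; exact: measurable_itv.
    rewrite setTI; apply/seteqP; split=> y /=; rewrite in_itv/= andbT; first exact.
    by move=> y0 _.
  refine (@cross_cov_separation R M d_ k_ H_ H (law (-1)) (law 1) A_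
    d0 ck bk tk chk _ mA _).
    by move=> m A mAA; rewrite -(marginal_shear_opp _ _ m12 1 mAA).
  rewrite lt_eqF// shear_law_quadrant// => x; split=> [Ax|[xi xj] m].
    have := Ax m1; have := Ax m2; rewrite /A_/= !blockE !inE !eqxx orbT/=.
    by move=> /(_ isT) xj /(_ isT) xi.
  by rewrite /A_/= !blockE !inE => /orP[] /eqP ->.
pose Delta := `|C 1 - C (-1)|.
have Delta0 : 0 < Delta by rewrite normr_gt0 subr_eq0 eq_sym.
pose kap : R := expR (1 / 2).
have kap1 : 1 <= kap.
  by have := expR_ge1Dx (1 / 2 : R); rewrite /kap; lra.
(* Some increment is at least [Delta / N] with [N <= (4 kap + 1) sqrt n]; the factor 2 leaves room
   for two disjoint balls. *)
exists (Delta / (2 * (4 * kap + 1))).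
  by rewrite divr_gt0// mulr_gt0//; lra.
move=> n n2; apply: le_ereal_inf_tmp => _ [F mF <-].
pose w : R := Num.sqrt n%:R.
have w1 : 1 <= w.
  by rewrite -[1]sqrtr1 ler_wsqrtr// ler1n (leq_trans _ n2).
have wE : w ^+ 2 = n%:R by rewrite sqr_sqrtr// ler0n.
have kw0 : 0 <= 4 * kap * w by rewrite !mulr_ge0//; lra.
(* The lower bound on [N] keeps [n] times the affinity loss below 1/4, using [kap >= 1]; in the
   upper bound the rounding error 1 is absorbed by [w >= 1]. *)
have [N [N_gt0 Ngt Nle]] : exists N : nat,
    [/\ (0 < N)%N, 4 * kap * w < N%:R & N%:R <= (4 * kap + 1) * w].
  have /andP[tle tgt] := truncn_itv kw0.
  exists (Num.truncn (4 * kap * w)).+1; split => //.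
  by rewrite -natr1 [leRHS]mulrDl mul1r lerD.
have N0 : 0 < N%:R :> R by rewrite ltr0n.
pose rr (s : nat) : R := -1 + 2 / N%:R * s%:R.
have [s sN incr] := exists_large_increment (fun s => C (rr s)) N_gt0.
have rr0 : rr 0%N = -1 by rewrite /rr mulr0 addr0.
have rrN : rr N = 1 by rewrite /rr divfK; [ring|rewrite gt_eqF].
have rrS : rr s.+1 = rr s + 2 / N%:R.
  by rewrite /rr (_ : s.+1%:R = s%:R + 1 :> R) ?natr1//; ring.
have {}incr : Delta / N%:R <= `|C (rr s.+1) - C (rr s)| by move: incr; rewrite rr0 rrN.
(* The affinity loss given by [shear_affinity] for one step of length [2 / N]. *)
pose e : R := (2 / N%:R) ^+ 2 * kap.
have kap0 : 0 < kap by lra.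
have w0 : 0 < w by lra.
have N2 : 16 * kap * n%:R <= N%:R ^+ 2.
  by rewrite -wE; nra.
have eE : e * N%:R ^+ 2 = 4 * kap by rewrite /e; field; rewrite gt_eqF.
have n1 : 1 <= n%:R :> R by rewrite ler1n (leq_trans _ n2).
have e0 : 0 <= e by rewrite /e mulr_ge0 ?sqr_ge0// ltW.
have ne : n%:R * e <= 4^-1.
  by rewrite -(ler_pM2r (_ : 0 < 16 * kap)) ?mulr_gt0//; nra.
have e01 : 0 <= e <= 1 by rewrite e0/=; nra.
pose t : R := Delta / (2 * (4 * kap + 1)) / w.
have gap : 2 * t <= `|C (rr s.+1) - C (rr s)|.
  apply: le_trans incr; rewrite ler_pdivlMr//.
  have -> : 2 * t = Delta / ((4 * kap + 1) * w).
    by rewrite /t; field; rewrite !gt_eqF//; lra.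
  rewrite mulrAC ler_pdivrMr ?mulr_gt0//; last by lra.
  by rewrite ler_wpM2l// ltW.
have densE g := shear_law_density ij (rr s) (2 / N%:R) (g := g).
have := two_point_testing (Q := law (rr s.+1)) (P := law (rr s))
  (measurable_shear_density i j (rr s) (2 / N%:R))
  (fun x => expR_ge0 _) _ e01 (shear_affinity ij (rr s) (2 / N%:R)) ne mF gap.
rewrite rrS => /(_ densE) test.
set S := ereal_sup _.

have big r : 6^-1 <= fine (power_prob (law r) n [set z | t <= `|C r - F z|]) ->
    ((6^-1)%:E <= S)%E.
  move=> h; apply: (@le_trans _ _ (power_prob (law r) n [set z | t <= `|C r - F z|])).
    rewrite -[leRHS]fineK ?lee_fin// fin_num_measure//.
    exact: measurable_deviation.
  by apply: ereal_sup_ubound; exists (law r).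
apply: (@le_trans _ _ (6^-1)%:E); first by rewrite lee_fin minimax_constant_le_sixth.
(* The two error probabilities sum to at least 1/3, so one of them reaches 1/6, and both laws belong
   to the class. *)
have [|small] := leP 6^-1 (fine (power_prob (law (rr s)) n
    [set z | t <= `|C (rr s) - F z|])); first exact: big.
by apply: (big (rr s.+1)); rewrite rrS; exact: sixth_le_of_sum test small.
Qed.
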